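(* Let $M>0$ and let $f=h+\overline{g}\in\mathcal{P}^0_{\mathcal{H}}(M)$ be given by $$f(z)=z+\sum_{n=2}^{\infty}a_nz^n+\overline{\sum_{n=2}^{\infty}b_nz^n}.$$ Suppose that $\{\varphi_n(r)\}_{n=0}^{\infty}\in\mathcal{F}$ satisfies $\varphi_0(1)=1$ (where $\varphi_0(1)$ is understood as $\lim_{r\to1^-}\varphi_0(r)$) and $$\sum_{n=2}^{\infty}\frac{\varphi_n(0)}{n(n-1)}<\frac{1}{2M}+1-\ln 4.$$ Then $$A_f(r):=r\varphi_0(r)+\sum_{n=2}^{\infty}\left(|a_n|+|b_n|\right)\varphi_n(r)\le d\left(f(0),\partial f(\mathbb{D})\right)$$ for $|z|=r\le R_f(M)$, where $R_f(M)$ is the unique positive root in $(0,1)$ of the equation $$r\varphi_0(r)+2M\sum_{n=2}^{\infty}\frac{\varphi_n(r)}{n(n-1)}=1+2M\sum_{n=2}^{\infty}\frac{(-1)^{n-1}}{n(n-1)}.$$ The radius $R_f(M)$ is best possible.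
   Context: $\mathbb{D}=\{z\in\mathbb{C}:|z|<1\}$. $\mathcal{H}_0$ is the class of complex-valued harmonic functions $f=h+\overline{g}$ on $\mathbb{D}$, with $h,g$ analytic in $\mathbb{D}$ and normalized by $h(0)=h'(0)-1=0$ and $g(0)=g'(0)=0$; thus $h(z)=z+\sum_{n\ge2}a_nz^n$ and $g(z)=\sum_{n\ge2}b_nz^n$. For $M>0$, $$\mathcal{P}^0_{\mathcal{H}}(M)=\{f=h+\overline{g}\in\mathcal{H}_0:\ \operatorname{Re}(zh''(z))>-M+|zg''(z)|\ \text{for all } z\in\mathbb{D}\}.$$ $\mathcal{F}$ is the set of all sequences $\{\varphi_n(r)\}_{n=0}^{\infty}$ of non-negative continuous functions on $[0,1)$ such that $\sum_{n=0}^{\infty}\varphi_n(r)$ converges locally uniformly on $[0,1)$. $d(f(0),\partial f(\mathbb{D}))$ is the Euclidean distance between $f(0)$ and the boundary of $f(\mathbb{D})$. ''$R_f(M)$ is best possible'' means that the inequality holds for every $f\in\mathcal{P}^0_{\mathcal{H}}(M)$ for $r\le R_f(M)$ and fails (for some $f$ in the class) when $r>R_f(M)$.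
   Formalization: The root need not be unique (φ_0 may oscillate), so a root with the inequality up to it is asserted and uniqueness is assumed only for ''best possible''; that clause also assumes M ≤ 1/ln 4, since for larger M the distance exceeds the right-hand side for every f. *)

(* Defs.v *)
From Stdlib Require Export Reals.
From Coquelicot Require Export Coquelicot.
Open Scope R_scope.

Definition unit_disk (z : C) : Prop := Cmod z < 1.

(* Complex differentiability at every point: the scalar field is [C], not the
   [R]-normed-module structure that [C] also carries. *)
Definition analytic_in_disk (h : C -> C) : Prop :=
  forall z : C, unit_disk z ->
    @ex_derive C_AbsRing C_NormedModule h z.

(* The harmonic mapping h + conj g; only its values on the disk matter. *)
Definition harmonic_map (h g : C -> C) (z : C) : C := (h z + Cconj (g z))%C.

Definition class_H0 (h g : C -> C) : Prop :=
  analytic_in_disk h /\ analytic_in_disk g /\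
  h 0%C = 0%C /\ C_derive h 0%C = 1%C /\
  g 0%C = 0%C /\ C_derive g 0%C = 0%C.

(* [C_derive] is total; here h' and h'' exist on the disk since h, g are
   analytic there. *)
Definition class_P0H (M : R) (h g : C -> C) : Prop :=
  class_H0 h g /\
  forall z : C, unit_disk z ->
    Re (z * C_derive (C_derive h) z)%C
      > - M + Cmod (z * C_derive (C_derive g) z)%C.

(* h(z) = z + sum_{n>=2} a_n z^n and g(z) = sum_{n>=2} b_n z^n on the disk;
   the entries of [a] and [b] at 0 and 1 are never used. *)
Definition has_coefficients (h g : C -> C) (a b : nat -> C) : Prop :=
  forall z : C, unit_disk z ->
    @is_series C_AbsRing C_NormedModule
      (fun k => (a (k + 2)%nat * z ^ (k + 2))%C) (h z - z)%C /\
    @is_series C_AbsRing C_NormedModule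
      (fun k => (b (k + 2)%nat * z ^ (k + 2))%C) (g z).

Definition continuous_on_01 (u : R -> R) : Prop :=
  forall r : R, 0 <= r < 1 ->
    filterlim u (within (fun x => 0 <= x < 1) (locally r)) (locally (u r)).

Definition class_F (phi : nat -> R -> R) : Prop :=
  (forall n : nat, continuous_on_01 (phi n)) /\
  (forall (n : nat) (r : R), 0 <= r < 1 -> 0 <= phi n r) /\
  (forall r0 : R, 0 <= r0 < 1 ->
     exists delta : posreal,
       CVU_dom (fun N r => sum_n (fun n => phi n r) N)
               (fun r => 0 <= r < 1 /\ Rabs (r - r0) < delta)).

(* sum_{n>=2} u_n *)
Definition Series2 (u : nat -> R) : R := Series (fun k => u (k + 2)%nat).

(* sum_{n>=2} phi_n(r) / (n(n-1)), convergent on [0,1) when [class_F phi]. *)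
Definition phi_sum (phi : nat -> R -> R) (r : R) : R :=
  Series2 (fun n => phi n r / (INR n * (INR n - 1))).

(* A_f(r).  The terms are nonnegative, so the sum is taken in [Rbar]: a
   divergent series would give +oo and not a default value. *)
Definition bohr_sum (a b : nat -> C) (phi : nat -> R -> R) (r : R) : Rbar :=
  Rbar_plus (Finite (r * phi 0%nat r))
    (Lim_seq (sum_n (fun k =>
       (Cmod (a (k + 2)%nat) + Cmod (b (k + 2)%nat)) * phi (k + 2)%nat r))).

Definition radius_equation (M : R) (phi : nat -> R -> R) (r : R) : Prop :=
  r * phi 0%nat r + 2 * M * phi_sum phi r
  = 1 + 2 * M * Series2 (fun n => (-1) ^ (n - 1) / (INR n * (INR n - 1))).

Definition image_disk (f : C -> C) (w : C) : Prop :=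
  exists z : C, unit_disk z /\ f z = w.

Definition boundary (E : C -> Prop) (w : C) : Prop :=
  forall eps : R, 0 < eps ->
    (exists u : C, E u /\ Cmod (u - w)%C < eps) /\
    (exists u : C, ~ E u /\ Cmod (u - w)%C < eps).

(* d(p, S), equal to +oo when S is empty. *)
Definition distance (p : C) (S : C -> Prop) : Rbar :=
  Glb_Rbar (fun d => exists w : C, S w /\ d = Cmod (w - p)%C).

(* d(f(0), boundary of f(D)) *)
Definition boundary_distance (f : C -> C) : Rbar :=
  distance (f 0%C) (boundary (image_disk f)).

(* Main.v *)
(** For |e| = 1 the function F = h + e g satisfies Re (z F'') > -M, so M + z F''
    has nonnegative real part and value M at 0. Caratheodory's bound on its
    coefficients gives |a_n| + |b_n| <= 2M/(n(n-1)). Harnack's inequality gives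
    Re (z F'') >= -2M|z|/(1+|z|); integrating twice along the radius gives
    Re F' >= 1 - 2M ln(1+|z|) and Re (conj z F) >= |z| l(|z|), where
    l(r) = r - 2M((1+r) ln(1+r) - r). A suitable e depending on z turns the
    latter into Re (conj z f(z)) >= |z| l(|z|). The number l(1) is the right-hand
    side of the radius equation.

    For M > 1/ln 4 the map f need not be univalent, so the lower bound on the
    boundary distance comes from a degree argument: if |w| < l(r), then f - w
    points outward on |z| = r, hence has winding number 1 there and vanishes in
    the disk. Thus f(D) contains the disk of radius l(1).

    The radius is the first root of the equation. For sharpness, the extremal
    map is z + 2M sum z^n/(n(n-1)): it is real exactly on the real axis, where it
    stays above -l(1), and its coefficients make A_f(r) equal to the left-hand
    side of the equation. *)

Require Import Defs.
From Stdlib Require Import Lra Lia Classical.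
Open Scope R_scope.

(* [ring] and [field] do not recognise [C] when it appears as the carrier of a
   Coquelicot structure. *)
Ltac eq_in_C := lazymatch goal with |- @eq _ ?a ?b => change (@eq C a b) end.

(** * Complex power series on the unit disk *)

(** Nothing is known on |z| = 1, so the coefficient bound and Harnack's inequality are both read off
    from finite trigonometric polynomials: a nonnegative one of degree N is tested against the
    series on a circle of radius r < 1, and then r tends to 1. The two bounds differ only in the
    test polynomial: the real part of 1 - eta e^(-ikt) for the first, a truncated Poisson kernel
    less its minimum for the second. The degree is likewise an explicit integral, that of d arg (f -
    w) over |z| = rho. If f omits w it does not depend on rho and vanishes at the centre, whereas
    outward pointing makes it 2 pi. In the radius equation, left side minus right side is negative
    at 0 by [hsum] and positive near 1 because r phi_0(r) tends to 1 > l(1). This yields a root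
    without limiting the number of roots. Up to the first root the inequality holds; beyond it the
    sign is controlled once there is no other root, hence the uniqueness premise of the last clause.
    Its premise M <= 1/ln 4 means 2M ln 2 <= 1, so that Re h' > 0 for the extremal map, which
    confines its real values to the real axis. *)

Definition is_pser (c : nat -> C) (H : C -> C) : Prop :=
  forall z : C, Cmod z < 1 ->
    @is_series C_AbsRing C_NormedModule (fun k => (c k * z ^ k)%C) (H z).

Definition dcoef (c : nat -> C) (k : nat) : C := (INR (S k) * c (S k))%C.

Lemma Cmod_series_le (u : nat -> C) (v : nat -> R) (lu : C) (lv : R) :
  @is_series C_AbsRing C_NormedModule u lu -> is_series v lv ->
  (forall k, Cmod (u k) <= v k) -> Cmod lu <= lv.
Proof.
  intros Hu Hv Huv.
  assert (Hn : is_lim_seq (fun n => Cmod (sum_n u n)) (Cmod lu)).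
  { apply (filterlim_comp _ _ _ (sum_n u) Cmod eventually (locally lu)).
    - exact Hu.
    - exact (@filterlim_norm C_AbsRing C_NormedModule lu). }
  refine (is_lim_seq_le _ _ (Finite (Cmod lu)) (Finite lv) _ Hn Hv).
  intro n.
  eapply Rle_trans.
  - exact (@norm_sum_n_m C_AbsRing C_NormedModule u 0 n).
  - apply (sum_n_m_le (fun k => Cmod (u k)) v). exact Huv.
Qed.

(** This is radius of convergence at least 1, put in terms of moduli so that results on real series
    apply. *)
Definition abs_conv (c : nat -> C) : Prop :=
  forall r : R, 0 <= r < 1 -> ex_series (fun k => Cmod (c k) * r ^ k).

(** Abel's argument: convergence at a point s between r and 1 bounds c_k s^k, and the remaining
    factor (r/s)^k is geometric. *)
Lemma is_pser_abs_conv (c : nat -> C) (H : C -> C) : is_pser c H -> abs_conv c.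
Proof.
  intros Hc r Hr.
  set (s := (1 + r) / 2).
  assert (Hs : r < s < 1) by (unfold s; lra).
  assert (Hsz : Cmod (RtoC s) < 1) by (rewrite Cmod_R, Rabs_pos_eq; lra).
  destruct (@filterlim_bounded C_AbsRing C_NormedModule
              (fun k => (c k * RtoC s ^ k)%C)) as [B HB].
  { pose proof (Hc _ Hsz) as Hser.
    set (u := fun k => (c k * RtoC s ^ k)%C) in *.
    (* A term is the difference of two consecutive partial sums, both tending to H s, so the terms
       converge and are therefore bounded. *)
    exists (@plus C_NormedModule (H s) (@opp C_NormedModule (H s))).
    apply filterlim_ext with
      (fun n => @plus C_NormedModule (@sum_n C_NormedModule u n)
         (@opp C_NormedModule
           (match n with O => @zero C_NormedModule | S m => @sum_n C_NormedModule u m end))).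
    { intros [|n].
      - rewrite sum_O. apply (@minus_zero_r C_NormedModule).
      - rewrite sum_Sn.
        change ((@sum_n C_NormedModule u n + u (S n) - @sum_n C_NormedModule u n)%C = u (S n)).
        ring. }
    eapply filterlim_comp_2; [exact Hser| |apply (@filterlim_plus C_AbsRing C_NormedModule)].
    eapply filterlim_comp; [|apply (@filterlim_opp C_AbsRing C_NormedModule)].
    intros P HP. destruct (Hser P HP) as [N HN].
    exists (S N). intros [|n] Hn; [lia|]. apply HN. lia. }
  apply (@ex_series_le R_AbsRing R_CompleteNormedModule _ (fun k => B * (r / s) ^ k)).
  - intro k.
    assert (Hrk : 0 <= Cmod (c k) * r ^ k)
      by (apply Rmult_le_pos; [apply Cmod_ge_0 | apply pow_le; lra]).
    change (Rabs (Cmod (c k) * r ^ k) <= B * (r / s) ^ k).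
    rewrite Rabs_pos_eq by exact Hrk.
    specialize (HB k). change (Cmod (c k * RtoC s ^ k) <= B) in HB.
    rewrite Cmod_mult, Cmod_pow, Cmod_R, Rabs_pos_eq in HB by lra.
    replace (r ^ k) with (s ^ k * (r / s) ^ k)
      by (rewrite <- Rpow_mult_distr; f_equal; field; lra).
    rewrite <- Rmult_assoc. apply Rmult_le_compat_r; [|exact HB].
    apply pow_le. apply Rdiv_le_0_compat; lra.
  - apply (@ex_series_scal R_AbsRing R_NormedModule B (fun k => (r / s) ^ k)).
    apply ex_series_geom. rewrite Rabs_pos_eq.
    + apply Rlt_div_l; lra.
    + apply Rdiv_le_0_compat; lra.
Qed.

Lemma abs_conv_ex (c : nat -> C) (z : C) :
  abs_conv c -> Cmod z < 1 ->
  @ex_series C_AbsRing C_NormedModule (fun k => (c k * z ^ k)%C).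
Proof.
  intros Hc Hz.
  apply (@ex_series_le C_AbsRing C_CompleteNormedModule _ (fun k => Cmod (c k) * Cmod z ^ k)).
  - intro k. change (Cmod (c k * z ^ k) <= Cmod (c k) * Cmod z ^ k).
    rewrite Cmod_mult, Cmod_pow. apply Rle_refl.
  - apply Hc. split; [apply Cmod_ge_0 | exact Hz].
Qed.

(** [Series] is real-valued, so the sum is assembled from its coordinates. This names the sums of
    the derived series, for which no function is given in advance. *)
Definition psum (c : nat -> C) (z : C) : C :=
  (Series (fun k => Re (c k * z ^ k)%C), Series (fun k => Im (c k * z ^ k)%C)).

Lemma sum_n_Re (u : nat -> C) (n : nat) :
  Re (@sum_n C_AbelianMonoid u n) = sum_n (fun k => Re (u k)) n.
Proof.
  induction n as [|n IH]; [now rewrite !sum_O|].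
  rewrite !sum_Sn, <- IH. reflexivity.
Qed.

Lemma sum_n_Im (u : nat -> C) (n : nat) :
  Im (@sum_n C_AbelianMonoid u n) = sum_n (fun k => Im (u k)) n.
Proof.
  induction n as [|n IH]; [now rewrite !sum_O|].
  rewrite !sum_Sn, <- IH. reflexivity.
Qed.

Lemma is_series_Re (u : nat -> C) (l : C) :
  @is_series C_AbsRing C_NormedModule u l -> is_series (fun k => Re (u k)) (Re l).
Proof.
  intro Hu. unfold is_series.
  eapply filterlim_ext; [intro n; apply sum_n_Re|].
  eapply filterlim_comp; [exact Hu|].
  intros P [eps HP]. exists eps. intros y Hy. apply HP. exact (proj1 Hy).
Qed.

Lemma is_series_Im (u : nat -> C) (l : C) :
  @is_series C_AbsRing C_NormedModule u l -> is_series (fun k => Im (u k)) (Im l).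
Proof.
  intro Hu. unfold is_series.
  eapply filterlim_ext; [intro n; apply sum_n_Im|].
  eapply filterlim_comp; [exact Hu|].
  intros P [eps HP]. exists eps. intros y Hy. apply HP. exact (proj2 Hy).
Qed.

Lemma is_pser_psum (c : nat -> C) : abs_conv c -> is_pser c (psum c).
Proof.
  intros Hc z Hz. destruct (abs_conv_ex c z Hc Hz) as [l Hl].
  replace (psum c z) with l; [exact Hl|].
  unfold psum. rewrite (surjective_pairing l). f_equal; symmetry; apply is_series_unique.
  - exact (is_series_Re _ _ Hl).
  - exact (is_series_Im _ _ Hl).
Qed.

(** The moduli of [dcoef c] are the coefficients of [PS_derive] applied to the real series of the
    |c_k|, and real differentiation preserves the radius of convergence. *)
Lemma abs_conv_dcoef (c : nat -> C) : abs_conv c -> abs_conv (dcoef c).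
Proof.
  intros Hc r Hr.
  set (m := fun k => Cmod (c k)).
  assert (Hrad : Rbar_lt (Rabs r) (CV_radius (PS_derive m))).
  { rewrite CV_radius_derive.
    apply Rbar_lt_le_trans with (Finite ((1 + r) / 2)).
    - simpl. rewrite Rabs_pos_eq; lra.
    - apply Rbar_not_lt_le. intro Hlt.
      assert (Hs : 0 <= (1 + r) / 2 < 1) by lra.
      apply (CV_disk_outside m ((1 + r) / 2)).
      + rewrite Rabs_pos_eq; [exact Hlt | lra].
      + apply ex_series_lim_0. exact (Hc _ Hs). }
  apply ex_series_ext with (2 := CV_disk_inside _ _ Hrad).
  intro k. unfold PS_derive, m, dcoef.
  rewrite Cmod_mult, Cmod_R, Rabs_pos_eq, (Rabs_pos_eq (INR (S k))).
  - reflexivity.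
  - apply pos_INR.
  - apply Rmult_le_pos; [apply Rmult_le_pos | apply pow_le; lra].
    + apply pos_INR.
    + apply Cmod_ge_0.
Qed.

(** The remainder e of one exponent gives (z + w) e + (k + 2) z^(k+1) w^2 for the next. The constant
    is chosen to be the factor of c_(k+2) in the second derived series at rho, so the estimate can
    be summed against coefficients. *)
Lemma pow_second_order (z w : C) (rho : R) (k : nat) :
  Cmod z <= rho -> Cmod (z + w) <= rho ->
  Cmod ((z + w) ^ S (S k) - z ^ S (S k) - INR (S (S k)) * z ^ S k * w)%C
    <= INR (S (S k)) * INR (S k) * rho ^ k * Cmod w ^ 2.
Proof.
  intros Hz Hzw.
  assert (Hrho : 0 <= rho) by (eapply Rle_trans; [apply Cmod_ge_0 | exact Hz]).
  induction k as [|k IH].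
  - replace ((z + w) ^ 2 - z ^ 2 - INR 2 * z ^ 1 * w)%C with (w ^ 2)%C
      by (simpl; rewrite !RtoC_plus; ring).
    rewrite Cmod_pow. simpl. pose proof (pow2_ge_0 (Cmod w)). simpl in H. lra.
  - set (e := ((z + w) ^ S (S k) - z ^ S (S k) - INR (S (S k)) * z ^ S k * w)%C) in *.
    replace ((z + w) ^ S (S (S k)) - z ^ S (S (S k)) - INR (S (S (S k))) * z ^ S (S k) * w)%C
      with ((z + w) * e + INR (S (S k)) * z ^ S k * w ^ 2)%C.
    2:{ unfold e. rewrite (S_INR (S (S k))), RtoC_plus. simpl Cpow. ring. }
    eapply Rle_trans; [apply Cmod_triangle|].
    rewrite !Cmod_mult, !Cmod_pow, Cmod_R, (Rabs_pos_eq (INR _)) by apply pos_INR.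
    assert (Hw2 : 0 <= Cmod w ^ 2) by apply pow2_ge_0.
    apply Rle_trans with
      (rho * (INR (S (S k)) * INR (S k) * rho ^ k * Cmod w ^ 2)
       + INR (S (S k)) * rho ^ S k * Cmod w ^ 2).
    + apply Rplus_le_compat.
      * apply Rmult_le_compat; auto using Cmod_ge_0.
      * apply Rmult_le_compat_r; [exact Hw2|].
        apply Rmult_le_compat_l; [apply pos_INR|].
        apply pow_incr. split; [apply Cmod_ge_0 | exact Hz].
    + rewrite (S_INR (S (S k))), (S_INR (S k)). simpl pow.
      pose proof (pos_INR (S k)) as Hk.
      assert (0 <= rho * rho ^ k) by (apply Rmult_le_pos; [exact Hrho | apply pow_le; exact Hrho]).
      simpl in Hw2.
      assert (0 <= rho * rho ^ k * (Cmod w * (Cmod w * 1))) by (apply Rmult_le_pos; assumption).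
      nra.
Qed.

Lemma is_series_opp_C (u : nat -> C) (l : C) :
  @is_series C_AbsRing C_NormedModule u l ->
  @is_series C_AbsRing C_NormedModule (fun k => (- u k)%C) (- l)%C.
Proof. exact (@is_series_opp C_AbsRing C_NormedModule u l). Qed.

Lemma is_series_plus_C (u v : nat -> C) (lu lv : C) :
  @is_series C_AbsRing C_NormedModule u lu ->
  @is_series C_AbsRing C_NormedModule v lv ->
  @is_series C_AbsRing C_NormedModule (fun k => (u k + v k)%C) (lu + lv)%C.
Proof. exact (@is_series_plus C_AbsRing C_NormedModule u v lu lv). Qed.

Lemma is_series_scal_C (a : C) (u : nat -> C) (l : C) :
  @is_series C_AbsRing C_NormedModule u l ->
  @is_series C_AbsRing C_NormedModule (fun k => (a * u k)%C) (a * l)%C.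
Proof. exact (@is_series_scal C_AbsRing C_NormedModule a u l). Qed.

Lemma is_series_decr_1_C (u : nat -> C) (l : C) :
  @is_series C_AbsRing C_NormedModule (fun k => u (S k)) l ->
  @is_series C_AbsRing C_NormedModule u (u 0%nat + l)%C.
Proof.
  intro Hu. apply (@is_series_decr_1 C_AbsRing C_NormedModule).
  match goal with |- is_series _ ?x => replace x with l; [exact Hu|] end.
  change (l = (u 0%nat + l + - u 0%nat)%C). ring.
Qed.

Lemma is_series_incr_1_C (u : nat -> C) (l : C) :
  @is_series C_AbsRing C_NormedModule u l ->
  @is_series C_AbsRing C_NormedModule (fun k => u (S k)) (l - u 0%nat)%C.
Proof.
  intro Hu. apply (@is_series_incr_1 C_AbsRing C_NormedModule).
  match goal with |- is_series _ ?x => replace x with l; [exact Hu|] end.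
  change (l = (l - u 0%nat + u 0%nat)%C). ring.
Qed.

(** One quadratic estimate serves both the complex derivative and real differentiability in the
    plane. K is the sum of the moduli of the second derived series at a radius halfway between |z|
    and 1. *)
Lemma pser_second_order (c : nat -> C) (H H' : C -> C) (z : C) :
  is_pser c H -> is_pser (dcoef c) H' -> Cmod z < 1 ->
  exists K delta : R, 0 <= K /\ 0 < delta /\
    forall w : C, Cmod w < delta ->
      Cmod (z + w)%C < 1 /\
      Cmod (H (z + w) - H z - H' z * w)%C <= K * Cmod w ^ 2.
Proof.
  intros Hc Hd Hz.
  set (rho := (1 + Cmod z) / 2).
  pose proof (Cmod_ge_0 z) as Hz0.
  assert (Hrho : Cmod z < rho < 1) by (unfold rho; lra).
  pose proof (is_pser_abs_conv c H Hc) as Habs.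
  destruct (abs_conv_dcoef _ (abs_conv_dcoef c Habs) rho ltac:(lra)) as [K HK].
  exists K, (rho - Cmod z). split; [|split; [lra|]].
  { refine (is_lim_seq_le (fun _ => 0) _ 0 K _ (is_lim_seq_const 0) HK).
    intro n.
    rewrite <- (Rmult_0_r (INR (S n - 0))), <- (sum_n_m_const 0 n 0).
    apply sum_n_m_le. intro k.
    apply Rmult_le_pos; [apply Cmod_ge_0 | apply pow_le; lra]. }
  intros w Hw.
  assert (Hzw : Cmod (z + w) <= rho)
    by (eapply Rle_trans; [apply Cmod_triangle | lra]).
  split; [lra|].
  assert (Hzw1 : Cmod (z + w) < 1) by lra.
  pose proof (is_series_incr_1_C _ _ (Hc _ Hzw1)) as S1.
  pose proof (is_series_incr_1_C _ _ (Hc _ Hz)) as S2.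
  pose proof (is_series_scal_C w _ _ (Hd _ Hz)) as S3.
  (* The constant terms were dropped in S1 and S2. Index 0 of this combination is c_1 (z + w) - c_1
     z - w c_1 = 0, so dropping it leaves the sum unchanged and only orders two and above remain. *)
  pose proof (is_series_incr_1_C _ _
    (is_series_plus_C _ _ _ _
      (is_series_plus_C _ _ _ _ S1 (is_series_opp_C _ _ S2))
      (is_series_opp_C _ _ S3))) as S4.
  assert (HKw : is_series (fun k => (Cmod (dcoef (dcoef c) k) * rho ^ k) * Cmod w ^ 2)
                  (K * Cmod w ^ 2)).
  { apply is_series_ext with (fun k => scal (Cmod w ^ 2) (Cmod (dcoef (dcoef c) k) * rho ^ k)).
    - intro k. apply Rmult_comm.
    - rewrite Rmult_comm. apply (@is_series_scal R_AbsRing R_NormedModule). exact HK. }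
  refine (Rle_trans _ _ _ _ (Cmod_series_le _ _ _ _ S4 HKw _)).
  - right. f_equal. unfold dcoef. simpl. ring.
  - intro k. cbv beta.
    replace (c (S (S k)) * (z + w) ^ S (S k) + - (c (S (S k)) * z ^ S (S k))
             + - (w * (dcoef c (S k) * z ^ S k)))%C
      with (c (S (S k)) * ((z + w) ^ S (S k) - z ^ S (S k) - INR (S (S k)) * z ^ S k * w))%C
      by (unfold dcoef; ring).
    rewrite Cmod_mult. unfold dcoef.
    rewrite !Cmod_mult, !Cmod_R, !(Rabs_pos_eq (INR _)) by apply pos_INR.
    eapply Rle_trans.
    + apply Rmult_le_compat_l; [apply Cmod_ge_0|].
      apply (pow_second_order z w rho k); lra.
    + right. ring.
Qed.

Lemma pser_is_derive (c : nat -> C) (H H' : C -> C) (z : C) :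
  is_pser c H -> is_pser (dcoef c) H' -> Cmod z < 1 ->
  @is_derive C_AbsRing C_NormedModule H z (H' z).
Proof.
  intros Hc Hd Hz.
  destruct (pser_second_order c H H' z Hc Hd Hz) as (K & delta & HK & Hdelta & Hb).
  split; [apply is_linear_scal_l|].
  intros x Hx.
  apply (@is_filter_lim_locally_unique C_AbsRing (AbsRing_NormedModule C_AbsRing)) in Hx. rewrite <- Hx.
  intro eps.
  assert (Hd' : 0 < Rmin delta (eps / (K + 1))).
  { apply Rmin_glb_lt; [exact Hdelta|]. apply Rdiv_lt_0_compat; [apply cond_pos | lra]. }
  exists (mkposreal _ Hd'). intros y Hy. change C in (type of y).
  change (Cmod (y - z)%C < Rmin delta (eps / (K + 1))) in Hy.
  change (Cmod ((H y - H z) - (y - z) * H' z)%C <= eps * Cmod (y - z)%C).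
  destruct (Hb (y - z)%C) as [_ Hb'].
  { eapply Rlt_le_trans; [exact Hy | apply Rmin_l]. }
  replace (z + (y - z))%C with y in Hb' by (generalize (y : C); intro y'; ring).
  replace (H y - H z - (y - z) * H' z)%C with (H y - H z - H' z * (y - z))%C by ring.
  eapply Rle_trans; [exact Hb'|].
  simpl. rewrite Rmult_1_r, <- Rmult_assoc.
  apply Rmult_le_compat_r; [apply Cmod_ge_0|].
  assert (Hy2 : Cmod (y - z) < eps / (K + 1))
    by (eapply Rlt_le_trans; [exact Hy | apply Rmin_r]).
  apply Rlt_div_r in Hy2; [|lra].
  pose proof (Cmod_ge_0 (y - z)). nra.
Qed.

(** * Series with nonnegative real part *)

Definition cis (t : R) : C := (cos t, sin t).

Lemma cis_pow (t : R) (n : nat) : (cis t ^ n)%C = cis (INR n * t).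
Proof.
  induction n as [|n IH].
  - unfold cis. simpl. rewrite Rmult_0_l, cos_0, sin_0. reflexivity.
  - rewrite Cpow_S, IH, S_INR. unfold cis, Cmult. simpl.
    replace ((INR n + 1) * t) with (t + INR n * t) by ring.
    rewrite cos_plus, sin_plus. f_equal; ring.
Qed.

Lemma Cmod_cis (t : R) : Cmod (cis t) = 1.
Proof.
  unfold Cmod, cis. simpl fst. simpl snd.
  rewrite <- sqrt_1. f_equal.
  pose proof (sin2_cos2 t). unfold Rsqr in H. simpl. lra.
Qed.

(** The two conditions at 2 PI stand in for integrality of [m], which will be a difference or a sum
    of naturals and may be negative. *)
Lemma is_RInt_trig_full_period (p q m : R) :
  m <> 0 -> cos (m * (2 * PI)) = 1 -> sin (m * (2 * PI)) = 0 ->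
  is_RInt (fun t => p * cos (m * t) + q * sin (m * t)) 0 (2 * PI) 0.
Proof.
  intros Hm Hc Hs.
  set (F := fun t => p / m * sin (m * t) - q / m * cos (m * t)).
  assert (E : minus (F (2 * PI)) (F 0) = 0).
  { unfold F, minus, plus, opp. simpl. rewrite Hc, Hs, (Rmult_0_r m), sin_0, cos_0. ring. }
  refine (eq_ind _ (fun v => is_RInt _ 0 (2 * PI) v) _ _ E).
  apply (is_RInt_derive (V := R_CompleteNormedModule)).
  - intros x _. unfold F. auto_derive; [exact I|]. field. exact Hm.
  - intros x _.
    apply continuity_pt_filterlim. apply derivable_continuous_pt.
    apply ex_derive_Reals_0. auto_derive. exact I.
Qed.

(* The bilinear form through which the k-th Fourier coefficients of two real
   trigonometric polynomials contribute to the mean of their product. *)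
Definition fourier_pair (x y : C) (k : nat) : R :=
  match k with O => 2 * Re x * Re y | S _ => Re (x * y)%C end.

Lemma cos_INR_2PI (n : nat) : cos (INR n * (2 * PI)) = 1.
Proof.
  rewrite <- cos_0, <- (cos_period 0 n). f_equal. ring.
Qed.

Lemma sin_INR_2PI (n : nat) : sin (INR n * (2 * PI)) = 0.
Proof.
  rewrite <- sin_0, <- (sin_period 0 n). f_equal. ring.
Qed.

(** From Re A Re B = (Re (A B) + Re (A conj B)) / 2 the integrand splits into frequencies j - k and
    j + k. Only a zero frequency survives integration: one of them for j = k > 0, both for j = k =
    0, which explains the separate case in [fourier_pair]. *)
Lemma is_RInt_fourier_pair (x y : C) (j k : nat) :
  is_RInt (fun t => Re (x * cis t ^ j)%C * Re (y * Cconj (cis t) ^ k)%C) 0 (2 * PI)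
    (if Nat.eqb j k then PI * fourier_pair x y k else 0).
Proof.
  set (f := fun t => Re (x * cis t ^ j)%C * Re (y * Cconj (cis t) ^ k)%C).
  assert (Hf : forall t, plus (/ 2 * Re (x * y)%C * cos ((INR j - INR k) * t)
                      + - (/ 2 * Im (x * y)%C) * sin ((INR j - INR k) * t))
                     (/ 2 * Re (x * Cconj y)%C * cos ((INR j + INR k) * t)
                      + - (/ 2 * Im (x * Cconj y)%C) * sin ((INR j + INR k) * t)) = f t).
  { intro t. unfold f. rewrite <- Cpow_conj, !cis_pow.
    replace ((INR j - INR k) * t) with (INR j * t - INR k * t) by ring.
    replace ((INR j + INR k) * t) with (INR j * t + INR k * t) by ring.
    rewrite cos_minus, sin_minus, cos_plus, sin_plus.
    unfold plus. simpl. unfold cis, Cmult, Re, Im. simpl. field. }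
  destruct (Nat.eqb_spec j k) as [<-|Hjk].
  - destruct j as [|j].
    + apply is_RInt_ext with (fun _ => Re x * Re y).
      { intros t _. unfold f. simpl Cpow. rewrite !Cmult_1_r. reflexivity. }
      replace (PI * fourier_pair x y 0) with (scal (2 * PI - 0) (Re x * Re y))
        by (unfold fourier_pair, scal; simpl; unfold mult; simpl; ring).
      apply (@is_RInt_const R_NormedModule).
    + eapply is_RInt_ext; [intros t _; apply Hf|].
      replace (PI * fourier_pair x y (S j))
        with (plus (scal (2 * PI - 0) (/ 2 * Re (x * y)%C)) 0)
        by (unfold fourier_pair, scal, plus; simpl; unfold mult; simpl; field).
      apply (@is_RInt_plus R_NormedModule).
      * eapply is_RInt_ext; [|apply (@is_RInt_const R_NormedModule)].
        intros t _. simpl. rewrite Rminus_diag, Rmult_0_l, cos_0, sin_0.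
        ring.
      * apply is_RInt_trig_full_period.
        { pose proof (lt_0_INR (S j) ltac:(lia)). lra. }
        { rewrite <- plus_INR. apply cos_INR_2PI. }
        { rewrite <- plus_INR. apply sin_INR_2PI. }
  - eapply is_RInt_ext; [intros t _; apply Hf|].
    refine (eq_ind (plus 0 0) (fun v => is_RInt _ 0 (2 * PI) v) _ _ (Rplus_0_r 0)).
    apply (@is_RInt_plus R_NormedModule); apply is_RInt_trig_full_period.
    + intro H. apply Hjk, INR_eq. lra.
    + rewrite Rmult_minus_distr_r, cos_minus, !cos_INR_2PI, !sin_INR_2PI. ring.
    + rewrite Rmult_minus_distr_r, sin_minus, !cos_INR_2PI, !sin_INR_2PI. ring.
    + intro H. apply Hjk, INR_eq.
      pose proof (pos_INR j). pose proof (pos_INR k). lra.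
    + rewrite <- plus_INR. apply cos_INR_2PI.
    + rewrite <- plus_INR. apply sin_INR_2PI.
Qed.

Lemma is_RInt_sum_n (f : nat -> R -> R) (v : nat -> R) (a b : R) (n : nat) :
  (forall k, (k <= n)%nat -> is_RInt (f k) a b (v k)) ->
  is_RInt (fun t => sum_n (fun k => f k t) n) a b (sum_n v n).
Proof.
  induction n as [|n IH]; intro Hf.
  - rewrite sum_O. eapply is_RInt_ext; [|apply Hf; lia].
    intros t _. now rewrite sum_O.
  - rewrite sum_Sn. eapply is_RInt_ext.
    { intros t _. symmetry. apply sum_Sn. }
    apply (@is_RInt_plus R_NormedModule).
    + apply IH. intros k Hk. apply Hf. lia.
    + apply Hf. lia.
Qed.

Lemma sum_n_delta (G : AbelianMonoid) (x : nat -> G) (k n : nat) :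
  sum_n (fun j => if Nat.eqb j k then x j else zero) n = if Nat.leb k n then x k else zero.
Proof.
  induction n as [|n IH].
  - rewrite sum_O. destruct k; reflexivity.
  - rewrite sum_Sn, IH.
    destruct (Nat.leb_spec k n), (Nat.leb_spec k (S n)), (Nat.eqb_spec (S n) k); try lia.
    + apply plus_zero_r.
    + subst k. apply plus_zero_l.
    + apply plus_zero_r.
Qed.

Definition trig_poly (x : nat -> C) (n : nat) (t : R) : C :=
  @sum_n C_AbelianMonoid (fun j => (x j * cis t ^ j)%C) n.

Definition conj_trig_poly (y : nat -> C) (n : nat) (t : R) : C :=
  @sum_n C_AbelianMonoid (fun j => (y j * Cconj (cis t) ^ j)%C) n.

(** A product of nonnegative functions has nonnegative integral, and orthogonality keeps only the
    frequencies common to both factors, each contributing PI times [fourier_pair]. *)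
Lemma trig_poly_pair_nonneg (x y : nat -> C) (n N : nat) :
  (N <= n)%nat ->
  (forall t, 0 <= Re (trig_poly x n t)) ->
  (forall t, 0 <= Re (conj_trig_poly y N t)) ->
  0 <= sum_n (fun k => fourier_pair (x k) (y k) k) N.
Proof.
  intros HN Hx Hy.
  assert (HI : is_RInt (fun t => Re (trig_poly x n t) * Re (conj_trig_poly y N t)) 0 (2 * PI)
                 (sum_n (fun k => PI * fourier_pair (x k) (y k) k) N)).
  { apply is_RInt_ext with
      (fun t => sum_n (fun k => sum_n (fun j =>
         Re (x j * cis t ^ j)%C * Re (y k * Cconj (cis t) ^ k)%C) n) N).
    { intros t _. unfold trig_poly, conj_trig_poly. rewrite !sum_n_Re.
      rewrite <- (@sum_n_mult_l R_Ring).
      apply sum_n_ext. intro k. apply (@sum_n_mult_r R_Ring). }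
    apply is_RInt_sum_n. intros k Hk.
    replace (PI * fourier_pair (x k) (y k) k) with
      (sum_n (fun j => if Nat.eqb j k then PI * fourier_pair (x j) (y k) k else zero) n).
    2:{ rewrite (sum_n_delta R_AbelianMonoid (fun j => PI * fourier_pair (x j) (y k) k)).
        destruct (Nat.leb_spec k n); [reflexivity | lia]. }
    apply is_RInt_sum_n. intros j _. apply is_RInt_fourier_pair. }
  rewrite (@sum_n_mult_l R_Ring PI) in HI.
  assert (0 <= PI * sum_n (fun k => fourier_pair (x k) (y k) k) N).
  { refine (is_RInt_ge_0 _ 0 (2 * PI) _ _ HI _).
    - pose proof PI_RGT_0. lra.
    - intros t _. apply Rmult_le_pos; auto. }
  pose proof PI_RGT_0. nra.
Qed.

Lemma pser_tail (c : nat -> C) (H : C -> C) (z : C) (l : R) (n : nat) :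
  is_pser c H -> Cmod z < 1 -> is_series (fun k => Cmod (c k) * Cmod z ^ k) l ->
  Cmod (H z - @sum_n C_AbelianMonoid (fun k => (c k * z ^ k)%C) n)%C
    <= l - sum_n (fun k => Cmod (c k) * Cmod z ^ k) n.
Proof.
  intros Hc Hz Hl.
  refine (Cmod_series_le (fun k => (c (S n + k)%nat * z ^ (S n + k))%C)
            (fun k => Cmod (c (S n + k)%nat) * Cmod z ^ (S n + k)) _ _ _ _ _).
  - apply (@is_series_incr_n C_AbsRing C_NormedModule (fun k => (c k * z ^ k)%C)); [lia|].
    match goal with |- is_series _ ?x => replace x with (H z); [exact (Hc z Hz)|] end.
    simpl pred. set (s := sum_n _ n). change (H z = (H z - s + s)%C). ring.
  - apply (is_series_incr_n (fun k => Cmod (c k) * Cmod z ^ k)); [lia|].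
    match goal with |- is_series _ ?x => replace x with l; [exact Hl|] end.
    simpl pred. set (s := sum_n _ n). change (l = (l - s + s)). ring.
  - intro k. rewrite Cmod_mult, Cmod_pow. apply Rle_refl.
Qed.

Lemma is_lim_seq_sum_n (u : nat -> nat -> R) (l : nat -> R) (N : nat) :
  (forall k, is_lim_seq (u k) (l k)) ->
  is_lim_seq (fun m => sum_n (fun k => u k m) N) (sum_n l N).
Proof.
  intro Hu. induction N as [|N IH].
  - rewrite sum_O. eapply is_lim_seq_ext; [|apply Hu]. intro m. now rewrite sum_O.
  - rewrite sum_Sn. eapply is_lim_seq_ext; [intro m; symmetry; apply sum_Sn|].
    apply (is_lim_seq_plus' _ _ _ _ IH (Hu (S N))).
Qed.

Lemma Cmod_scaled_cis (R0 t : R) : 0 <= R0 -> Cmod (R0 * cis t)%C = R0.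
Proof.
  intro HR. rewrite Cmod_mult, Cmod_cis, Cmod_R, Rabs_pos_eq by exact HR. ring.
Qed.

(* Herglotz positivity: on each circle of radius < 1 a partial sum of the
   series plus its tail bound is a nonnegative trigonometric polynomial. *)
Lemma pser_pair_nonneg (c y : nat -> C) (H : C -> C) (N : nat) :
  is_pser c H -> (forall z, Cmod z < 1 -> 0 <= Re (H z)) ->
  (forall t, 0 <= Re (conj_trig_poly y N t)) ->
  0 <= sum_n (fun k => fourier_pair (c k) (y k) k) N.
Proof.
  intros Hc Hpos Hy.
  assert (Hr : forall r, 0 <= r < 1 ->
            0 <= sum_n (fun k => fourier_pair (c k) (y k) k * r ^ k) N).
  { intros r Hr.
    destruct (is_pser_abs_conv c H Hc r Hr) as [l Hl].
    set (tau := fun n => l - sum_n (fun k => Cmod (c k) * r ^ k) n).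
    set (x := fun (n k : nat) => (c k * RtoC r ^ k + (if Nat.eqb k 0 then RtoC (tau n) else 0))%C).
    assert (Hn : forall n, (N <= n)%nat ->
              0 <= sum_n (fun k => fourier_pair (x n k) (y k) k) N).
    { intros n Hn. apply (trig_poly_pair_nonneg _ _ n N Hn); [|exact Hy].
      intro t.
      assert (Hz : Cmod (r * cis t)%C = r) by (apply Cmod_scaled_cis; lra).
      assert (Ht : trig_poly (x n) n t =
        (@sum_n C_AbelianMonoid (fun k => c k * (r * cis t) ^ k)%C n + tau n)%C).
      { unfold trig_poly.
        rewrite (sum_n_ext _ (fun k => @plus C_AbelianMonoid (c k * (r * cis t) ^ k)%C
                  (if Nat.eqb k 0 then (RtoC (tau n)) else zero))).
        - rewrite (@sum_n_plus C_AbelianMonoid), (sum_n_delta C_AbelianMonoid).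
          reflexivity.
        - intros [|k]; unfold x; simpl Nat.eqb; cbv iota.
          + change (@plus C_AbelianMonoid) with Cplus. simpl.
            eq_in_C. ring.
          + change (@plus C_AbelianMonoid) with Cplus.
            change (@zero C_AbelianMonoid) with (RtoC 0).
            rewrite Cpow_mult_l.
            eq_in_C. ring. }
      rewrite Ht, re_plus, re_RtoC.
      pose proof (pser_tail c H (r * cis t)%C l n Hc) as Htail.
      rewrite Hz in Htail. specialize (Htail (proj2 Hr) Hl).
      fold (tau n) in Htail.
      pose proof (re_le_Cmod (H (r * cis t) - @sum_n C_AbelianMonoid (fun k => c k * (r * cis t) ^ k)%C n)%C) as Hre.
      unfold Cminus in Hre at 1. rewrite re_plus, re_opp in Hre.
      specialize (Hpos (r * cis t)%C). rewrite Hz in Hpos. specialize (Hpos (proj2 Hr)).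
      apply Rabs_le_between in Hre. unfold Cminus in Htail. unfold Cminus in Hre. lra. }
    assert (Htau : is_lim_seq tau 0).
    { replace (Finite 0) with (Finite (l - l)) by (f_equal; ring).
      apply is_lim_seq_minus'; [apply is_lim_seq_const | exact Hl]. }
    refine (is_lim_seq_le_loc (fun _ => 0) _ 0 (sum_n (fun k => fourier_pair (c k) (y k) k * r ^ k) N) _
              (is_lim_seq_const 0) (is_lim_seq_sum_n (fun k n => fourier_pair (x n k) (y k) k) _ N _)).
    - exists N. exact Hn.
    - intros [|k].
      + unfold fourier_pair, x. simpl.
        apply is_lim_seq_ext with (fun n => 2 * (Re (c 0%nat) + tau n) * Re (y 0%nat)).
        { intro n. unfold Re, Cmult; simpl. ring. }
        replace (2 * Re (c 0%nat) * Re (y 0%nat) * 1)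
          with (2 * (Re (c 0%nat) + 0) * Re (y 0%nat)) by ring.
        apply is_lim_seq_mult'; [|apply is_lim_seq_const].
        apply is_lim_seq_mult'; [apply is_lim_seq_const|].
        apply is_lim_seq_plus'; [apply is_lim_seq_const | exact Htau].
      + eapply is_lim_seq_ext; [|apply is_lim_seq_const].
        intro n. unfold fourier_pair, x. simpl Nat.eqb. cbv iota.
        rewrite <- RtoC_pow, Cplus_0_r.
        replace (c (S k) * (r ^ S k)%R * y (S k))%C with ((r ^ S k)%R * (c (S k) * y (S k)))%C by ring.
        rewrite re_scal_l. ring. }
  (* With N fixed only finitely many powers of r occur, so r can tend to 1 by continuity; r = 1 -
     1/(m+1) lies in [0,1) already for m = 0. *)
  refine (is_lim_seq_le (fun _ => 0)
            (fun m => sum_n (fun k => fourier_pair (c k) (y k) k * (1 - / (INR m + 1)) ^ k) N)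
            0 (Finite (sum_n (fun k => fourier_pair (c k) (y k) k) N)) _ (is_lim_seq_const 0) _).
  - intro m. apply Hr.
    pose proof (pos_INR m) as Hm.
    assert (0 < / (INR m + 1)) by (apply Rinv_0_lt_compat; lra).
    assert (/ (INR m + 1) <= 1) by (rewrite <- Rinv_1; apply Rinv_le_contravar; lra).
    lra.
  - apply (is_lim_seq_sum_n (fun k m => fourier_pair (c k) (y k) k * (1 - / (INR m + 1)) ^ k)).
    intro k. cbv beta.
    replace (Finite (fourier_pair (c k) (y k) k)) with (Finite (fourier_pair (c k) (y k) k * 1))
      by (f_equal; ring).
    apply is_lim_seq_mult'; [apply is_lim_seq_const|].
    replace (Finite 1) with (Finite ((fun s => (1 - s) ^ k) 0))
      by (f_equal; cbv beta; rewrite Rminus_0_r; apply pow1).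
    apply (is_lim_seq_continuous (fun s => (1 - s) ^ k) (fun m => / (INR m + 1))).
    + apply derivable_continuous_pt, ex_derive_Reals_0. auto_derive. exact I.
    + apply is_lim_seq_ext with (fun m => / INR (S m)).
      { intro m. now rewrite S_INR. }
      apply (is_lim_seq_incr_1 (fun m => / INR m)).
      replace (Finite 0) with (Rbar_inv p_infty) by reflexivity.
      apply is_lim_seq_inv; [apply is_lim_seq_INR | discriminate].
Qed.

Lemma unit_rotation (x : C) : exists eta : C, Cmod eta = 1 /\ (x * eta)%C = Cmod x.
Proof.
  destruct (Req_dec (Cmod x) 0) as [Hx|Hx].
  - exists 1%C. rewrite Cmod_1, Hx. apply Cmod_eq_0 in Hx. subst x.
    split; [reflexivity | ring].
  - assert (Hx0 : RtoC (Cmod x) <> 0) by (intro E; apply RtoC_inj in E; auto).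
    exists (Cconj x / Cmod x)%C. split.
    + rewrite Cmod_div, Cmod_conj, Cmod_R, Rabs_pos_eq by (assumption || apply Cmod_ge_0).
      field. exact Hx.
    + transitivity ((x * Cconj x) / Cmod x)%C; [field; exact Hx0|].
      rewrite <- Cmod2_conj, RtoC_pow. field. exact Hx0.
Qed.

(** The test polynomial is the real part of 1 - eta e^(-ikt), with eta rotating c_k to |c_k|. Only
    indices 0 and k are paired, and the pairing is 2 Re c_0 - |c_k|. *)
Lemma caratheodory_coef_bound (c : nat -> C) (H : C -> C) (k : nat) :
  is_pser c H -> (forall z, Cmod z < 1 -> 0 <= Re (H z)) -> (1 <= k)%nat ->
  Cmod (c k) <= 2 * Re (c 0%nat).
Proof.
  intros Hc Hpos Hk.
  destruct (unit_rotation (c k)) as (eta & Heta & Hck).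
  set (y := fun j => @plus C_AbelianMonoid (if Nat.eqb j 0 then RtoC 1 else zero)
                       (if Nat.eqb j k then Copp eta else zero)).
  assert (Hy : forall t, 0 <= Re (conj_trig_poly y k t)).
  { intro t.
    assert (E : conj_trig_poly y k t = (1 - eta * Cconj (cis t) ^ k)%C).
    { unfold conj_trig_poly.
      rewrite (sum_n_ext _ (fun j => @plus C_AbelianMonoid
          (if Nat.eqb j 0 then RtoC 1 else zero)
          (if Nat.eqb j k then (- eta * Cconj (cis t) ^ j)%C else zero))).
      - rewrite (@sum_n_plus C_AbelianMonoid),
          (sum_n_delta C_AbelianMonoid (fun _ => RtoC 1)), 
          (sum_n_delta C_AbelianMonoid (fun j => (- eta * Cconj (cis t) ^ j)%C)), Nat.leb_refl.
        change (@plus C_AbelianMonoid) with Cplus. simpl Nat.leb. cbv iota. ring.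
      - intro j. unfold y.
        change (@plus C_AbelianMonoid) with Cplus.
        change (@zero C_AbelianMonoid) with (RtoC 0).
        destruct j as [|j]; [destruct k; [lia|] | destruct (Nat.eqb_spec (S j) k)]; simpl Nat.eqb; cbv iota;
          eq_in_C; simpl Cpow; ring. }
    rewrite E. unfold Cminus. rewrite re_plus, re_opp, re_RtoC.
    pose proof (re_le_Cmod (eta * Cconj (cis t) ^ k)%C) as Hre.
    rewrite Cmod_mult, Cmod_pow, Cmod_conj, Cmod_cis, pow1, Heta in Hre.
    apply Rabs_le_between in Hre. lra. }
  pose proof (pser_pair_nonneg c y H k Hc Hpos Hy) as Hp.
  rewrite (sum_n_ext _ (fun j => plus (if Nat.eqb j 0 then 2 * Re (c j) else zero)
                (if Nat.eqb j k then - Re (c j * eta)%C else zero))) in Hp.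
  - rewrite sum_n_plus, (sum_n_delta R_AbelianMonoid (fun j => 2 * Re (c j))),
      (sum_n_delta R_AbelianMonoid (fun j => - Re (c j * eta)%C)), Nat.leb_refl, Hck, re_RtoC in Hp.
    unfold plus in Hp. simpl in Hp. lra.
  - intro j. unfold y.
    change (@plus C_AbelianMonoid) with Cplus.
    change (@zero C_AbelianMonoid) with (RtoC 0).
    change (@plus R_AbelianMonoid) with Rplus.
    change (@zero R_AbelianMonoid) with 0.
    destruct j as [|j]; [destruct k; [lia|]|destruct (Nat.eqb_spec (S j) k)];
      simpl Nat.eqb; cbv iota;
      unfold fourier_pair, Re, Cmult, Cplus, Copp; simpl; ring.
Qed.

Lemma one_minus_neq_0 (z : C) : Cmod z < 1 -> (1 - z)%C <> 0%C.
Proof.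
  intros Hz E. assert (z = 1)%C by (replace z with (1 - (1 - z))%C by ring; rewrite E; ring).
  subst z. rewrite Cmod_1 in Hz. lra.
Qed.

Lemma Re_inv_one_minus (z : C) :
  Re (/ (1 - z))%C = (1 - Re z) / ((1 - Re z) ^ 2 + Im z ^ 2).
Proof.
  unfold Cinv, Cminus, Cplus, Copp, RtoC, Rminus, Re, Im. cbn [fst snd].
  rewrite Rplus_0_l. replace ((- snd z) ^ 2) with (snd z ^ 2) by ring. reflexivity.
Qed.

(** The sum equals 1/(1-w) - w^(N+1)/(1-w). On |w| = r the first part has its least real part at w =
    -r, and the second is bounded in modulus through |1-w| >= 1-r. *)
Lemma geometric_kernel_bound (w : C) (r : R) (N : nat) :
  Cmod w = r -> r < 1 ->
  / (1 + r) - r ^ S N / (1 - r) <= Re (@sum_n C_AbelianMonoid (fun k => w ^ k)%C N).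
Proof.
  intros Hw Hr.
  assert (Hr0 : 0 <= r) by (rewrite <- Hw; apply Cmod_ge_0).
  assert (Hw1 : (1 - w)%C <> 0%C) by (apply one_minus_neq_0; lra).
  assert (E : @sum_n C_AbelianMonoid (fun k => w ^ k)%C N = (/ (1 - w) - w ^ S N / (1 - w))%C).
  { induction N as [|N IH].
    - rewrite sum_O. eq_in_C. simpl. field. exact Hw1.
    - rewrite sum_Sn, IH. change (@plus C_AbelianMonoid) with Cplus.
      eq_in_C. simpl Cpow. field. exact Hw1. }
  rewrite E. unfold Cminus at 1. rewrite re_plus, re_opp.
  apply Rplus_le_compat.
  - assert (Hxy : Re w ^ 2 + Im w ^ 2 = r ^ 2) by (rewrite <- Hw; symmetry; apply Cmod2_alt).
    pose proof (re_le_Cmod w) as Hre. rewrite Hw in Hre. apply Rabs_le_between in Hre.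
    rewrite Re_inv_one_minus. set (x := Re w) in *. set (y := Im w) in *.
    assert (Hd : 0 < (1 - x) ^ 2 + y ^ 2) by nra.
    apply Rmult_le_reg_r with ((1 + r) * ((1 - x) ^ 2 + y ^ 2)); [nra|].
    replace (/ (1 + r) * ((1 + r) * ((1 - x) ^ 2 + y ^ 2))) with ((1 - x) ^ 2 + y ^ 2) by (field; lra).
    replace ((1 - x) / ((1 - x) ^ 2 + y ^ 2) * ((1 + r) * ((1 - x) ^ 2 + y ^ 2)))
      with ((1 - x) * (1 + r)) by (field; lra).
    (* Since x^2 + y^2 = r^2, this product is exactly the difference of the two sides after clearing
       denominators. *)
    assert (0 <= (1 - r) * (r + x)) by (apply Rmult_le_pos; lra).
    lra.
  - apply Ropp_le_contravar.
    pose proof (re_le_Cmod (w ^ S N / (1 - w))%C) as Hre.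
    rewrite Cmod_div, Cmod_pow, Hw in Hre by exact Hw1.
    apply Rabs_le_between in Hre.
    apply Rle_trans with (r ^ S N / Cmod (1 - w)%C); [lra|].
    apply Rmult_le_compat_l; [apply pow_le; exact Hr0|].
    apply Rinv_le_contravar; [lra|].
    pose proof (Cmod_triangle (1 - w) w) as Ht.
    replace (1 - w + w)%C with (RtoC 1) in Ht by ring.
    rewrite Cmod_1 in Ht. lra.
Qed.

(** The factor 2/(1+r) - 1 is the usual (1-r)/(1+r), the minimum of the Poisson kernel on |z| = r.
    The test polynomial is the real part of 2 sum (z e^(-it))^k plus the constant [d N] that makes
    it nonnegative; [d N] tends to -2/(1+r). *)
Lemma harnack_lower (c : nat -> C) (H : C -> C) (z : C) :
  is_pser c H -> (forall z, Cmod z < 1 -> 0 <= Re (H z)) -> Cmod z < 1 ->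
  Re (c 0%nat) * (2 / (1 + Cmod z) - 1) <= Re (H z).
Proof.
  intros Hc Hpos Hz.
  set (r := Cmod z) in *.
  assert (Hr0 : 0 <= r) by apply Cmod_ge_0.
  set (d := fun N => 2 * (r ^ S N / (1 - r)) - 2 / (1 + r)).
  set (S := fun N => sum_n (fun k => Re (c k * z ^ k)%C) N).
  assert (HN : forall N, - (Re (c 0%nat) * (1 + d N)) <= S N).
  { intro N.
    set (y := fun j => @plus C_AbelianMonoid (2 * z ^ j)%C (if Nat.eqb j 0 then RtoC (d N) else zero)).
    assert (Hy : forall t, 0 <= Re (conj_trig_poly y N t)).
    { intro t.
      assert (E : conj_trig_poly y N t =
        (2 * @sum_n C_AbelianMonoid (fun k => (z * Cconj (cis t)) ^ k)%C N + d N)%C).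
      { unfold conj_trig_poly.
        rewrite (sum_n_ext _ (fun j => @plus C_AbelianMonoid
            (2 * (z * Cconj (cis t)) ^ j)%C
            (if Nat.eqb j 0 then RtoC (d N) else zero))).
        - rewrite (@sum_n_plus C_AbelianMonoid),
            (sum_n_delta C_AbelianMonoid (fun _ => RtoC (d N))).
          exact (f_equal (fun s => (s + d N)%C)
                   (@sum_n_mult_l C_Ring (RtoC 2) (fun k => (z * Cconj (cis t)) ^ k)%C N)).
        - intros [|j]; unfold y; rewrite Cpow_mult_l;
            change (@plus C_AbelianMonoid) with Cplus;
            change (@zero C_AbelianMonoid) with (RtoC 0);
            eq_in_C; simpl; ring. }
      rewrite E, re_plus, re_scal_l, re_RtoC.
      assert (Hw : Cmod (z * Cconj (cis t))%C = r)
        by (rewrite Cmod_mult, Cmod_conj, Cmod_cis; unfold r; ring).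
      pose proof (geometric_kernel_bound _ r N Hw Hz). unfold d. lra. }
    pose proof (pser_pair_nonneg c y H N Hc Hpos Hy) as Hp.
    rewrite (sum_n_ext _ (fun j => plus (2 * Re (c j * z ^ j)%C)
                  (if Nat.eqb j 0 then 2 * Re (c j) * (1 + d N) else zero))) in Hp.
    - rewrite sum_n_plus, (sum_n_delta R_AbelianMonoid (fun j => 2 * Re (c j) * (1 + d N))) in Hp.
      rewrite (sum_n_mult_l (K := R_Ring) 2 (fun j => Re (c j * z ^ j)%C)) in Hp.
      change (0 <= 2 * S N + 2 * Re (c 0%nat) * (1 + d N)) in Hp. lra.
    - intros [|j]; unfold y;
        change (@plus C_AbelianMonoid) with Cplus;
        change (@zero C_AbelianMonoid) with (RtoC 0); unfold plus, zero; simpl Nat.eqb; cbv iota;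
        unfold fourier_pair; rewrite ?Cplus_0_r.
      + unfold Re, Cmult, Cplus. simpl. ring.
      + replace (c (Datatypes.S j) * (2 * z ^ Datatypes.S j))%C
          with (2 * (c (Datatypes.S j) * z ^ Datatypes.S j))%C by ring.
        rewrite re_scal_l. simpl. ring. }
  refine (is_lim_seq_le _ _ (Finite _) (Finite _) HN _ (is_series_Re _ _ (Hc z Hz))).
  apply is_lim_seq_ext with (fun N => (- Re (c 0%nat) * (1 - 2 / (1 + r))) +
                                 (- Re (c 0%nat) * (2 * r / (1 - r))) * r ^ N).
  { intro N. unfold d. simpl. field. lra. }
  replace (Re (c 0%nat) * (2 / (1 + r) - 1)) with
     ((- Re (c 0%nat) * (1 - 2 / (1 + r))) + (- Re (c 0%nat) * (2 * r / (1 - r))) * 0) by ring.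
  apply is_lim_seq_plus'; [apply is_lim_seq_const|].
  apply is_lim_seq_mult'; [apply is_lim_seq_const|].
  apply is_lim_seq_geom. rewrite Rabs_pos_eq; lra.
Qed.

(** * Growth of half-plane mappings *)

(** The factor [xi] selects a real coordinate of H: 1 gives the real part, -i the imaginary part.
    The Cauchy-Riemann equations appear as the factor [Ci] in the second partial derivative. *)
Lemma pser_differentiable (c : nat -> C) (H H' : C -> C) (xi : C) (x y : R) :
  is_pser c H -> is_pser (dcoef c) H' -> Cmod (x, y) < 1 ->
  differentiable_pt_lim (fun u v => Re (xi * H (u, v))%C) x y
    (Re (xi * H' (x, y))%C) (Re (xi * (Ci * H' (x, y)))%C).
Proof.
  intros Hc Hd Hz eps.
  destruct (pser_second_order c H H' (x, y) Hc Hd Hz) as (K & delta & HK & Hdelta & Hb).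
  pose proof (Cmod_ge_0 xi) as Hxi.
  set (Q := Cmod xi * K * 4 + 1).
  assert (HQ : 0 < Q) by (unfold Q; nra).
  assert (He : 0 < Rmin (delta / 2) (eps / Q)).
  { apply Rmin_glb_lt; [lra|]. apply Rdiv_lt_0_compat; [apply cond_pos | exact HQ]. }
  exists (mkposreal _ He). cbn [pos]. intros u v Hu Hv.
  set (m := Rmax (Rabs (u - x)) (Rabs (v - y))).
  assert (Hm : m < Rmin (delta / 2) (eps / Q)) by (apply Rmax_lub_lt; assumption).
  assert (Hm0 : 0 <= m) by (eapply Rle_trans; [apply Rabs_pos | apply Rmax_l]).
  set (w := (u - x, v - y) : C).
  assert (Hw : Cmod w <= 2 * m).
  { eapply Rle_trans; [apply Cmod_2Rmax|]. fold m. apply Rmult_le_compat_r; [exact Hm0|].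
    pose proof (sqrt_sqrt 2 ltac:(lra)). pose proof (sqrt_pos 2). nra. }
  destruct (Hb w) as [_ Hb'].
  { eapply Rle_lt_trans; [exact Hw|].
    pose proof (Rmin_l (delta / 2) (eps / Q)). lra. }
  replace ((x, y) + w)%C with (u, v) in Hb' by (unfold w, Cplus; simpl; f_equal; ring).
  set (E := (H (u, v) - H (x, y) - H' (x, y) * w)%C) in *.
  replace (Re (xi * H (u, v))%C - Re (xi * H (x, y))%C -
     (Re (xi * H' (x, y))%C * (u - x) + Re (xi * (Ci * H' (x, y)))%C * (v - y)))
    with (Re (xi * E)%C).
  2:{ unfold E, w, Cminus, Cplus, Copp, Cmult, Re, Ci. simpl. ring. }
  eapply Rle_trans; [apply re_le_Cmod|]. rewrite Cmod_mult.
  apply Rle_trans with (Cmod xi * (K * (2 * m) ^ 2)).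
  - apply Rmult_le_compat_l; [exact Hxi|].
    eapply Rle_trans; [exact Hb'|]. apply Rmult_le_compat_l; [exact HK|].
    apply pow_incr. split; [apply Cmod_ge_0 | exact Hw].
  - assert (Hm2 : m < eps / Q) by (eapply Rlt_le_trans; [exact Hm | apply Rmin_r]).
    apply Rlt_div_r in Hm2; [|exact HQ].
    unfold Q in Hm2.
    replace (Cmod xi * (K * (2 * m) ^ 2)) with ((m * (Cmod xi * K * 4)) * m) by ring.
    apply Rmult_le_compat_r; [exact Hm0|]. nra.
Qed.

Lemma pser_derive_line (c : nat -> C) (H H' : C -> C) (xi p w : C) (s : R) :
  is_pser c H -> is_pser (dcoef c) H' -> Cmod (p + s * w)%C < 1 ->
  derivable_pt_lim (fun t => Re (xi * H (p + t * w))%C) s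
    (Re (xi * (w * H' (p + s * w)))%C).
Proof.
  intros Hc Hd Hz.
  assert (E : forall t, (fst p + t * fst w, snd p + t * snd w) = (p + RtoC t * w)%C).
  { intro t. unfold Cplus, Cmult, RtoC. simpl. f_equal; ring. }
  pose proof (derivable_pt_lim_comp_2d (fun u v => Re (xi * H (u, v))%C)
    (fun t => fst p + t * fst w) (fun t => snd p + t * snd w) s
    (Re (xi * H' (p + s * w))%C) (Re (xi * (Ci * H' (p + s * w)))%C) (fst w) (snd w)) as HD.
  cbv beta in HD.
  assert (Hlin : forall a b, derivable_pt_lim (fun t => a + t * b) s b).
  { intros a b. apply is_derive_Reals. auto_derive; [exact I | ring]. }
  rewrite <- E in HD.
  specialize (HD (pser_differentiable c H H' xi _ _ Hc Hd ltac:(rewrite E; exact Hz))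
                 (Hlin _ _) (Hlin _ _)).
  rewrite !E in HD.
  replace (Re (xi * (w * H' (p + s * w)))%C)
    with (Re (xi * H' (p + s * w))%C * fst w + Re (xi * (Ci * H' (p + s * w)))%C * snd w)
    by (unfold Cmult, Re, Ci; simpl; ring).
  apply is_derive_Reals. apply is_derive_Reals in HD.
  eapply is_derive_ext; [|exact HD]. intro t. cbv beta. rewrite E. reflexivity.
Qed.

Lemma pser_at_0 (d : nat -> C) (G : C -> C) : is_pser d G -> G 0%C = d 0%nat.
Proof.
  intro Hd.
  assert (H0 : Cmod 0 < 1) by (rewrite Cmod_0; lra).
  pose proof (pser_tail d G 0%C (Cmod (d 0%nat)) 0 Hd H0) as Ht.
  rewrite !sum_O, Cmod_0 in Ht. simpl in Ht.
  assert (Hs : is_series (fun k => Cmod (d k) * 0 ^ k) (Cmod (d 0%nat))).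
  { unfold is_series. apply filterlim_ext with (fun _ => Cmod (d 0%nat)); [|apply filterlim_const].
    intro n. induction n as [|n IH].
    - rewrite sum_O. simpl. ring.
    - rewrite sum_Sn, <- IH. unfold plus. simpl. ring. }
  specialize (Ht Hs).
  assert (E : (G 0%C - d 0%nat * 1)%C = 0%C).
  { apply Cmod_eq_0. pose proof (Cmod_ge_0 (G 0%C - d 0%nat * 1)%C). lra. }
  replace (G 0%C) with ((G 0%C - d 0%nat * 1) + d 0%nat)%C by ring. rewrite E. ring.
Qed.

(* The minorant of |f| on the circle |z| = r: r + 2M sum_{n>=2} (-1)^(n-1) r^n / (n(n-1)). *)
Definition lower_growth (M r : R) : R := r - 2 * M * ((1 + r) * ln (1 + r) - r).

Lemma Cmod_scal_lt (u : R) (z : C) : 0 <= u <= 1 -> Cmod z < 1 -> Cmod (u * z)%C < 1.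
Proof.
  intros Hu Hz. rewrite Cmod_mult, Cmod_R, Rabs_pos_eq by lra.
  pose proof (Cmod_ge_0 z). nra.
Qed.

Section HalfPlane.

Variables (M : R) (A : nat -> C) (F : C -> C).
Hypothesis hF : is_pser A F.
Hypothesis hA0 : A 0%nat = 0%C.
Hypothesis hA1 : A 1%nat = 1%C.
Hypothesis hpos : forall z, Cmod z < 1 -> - M < Re (z * psum (dcoef (dcoef A)) z)%C.

Let habs : abs_conv A := is_pser_abs_conv A F hF.
Let h1 : is_pser (dcoef A) (psum (dcoef A)) := is_pser_psum _ (abs_conv_dcoef _ habs).
Let h2 : is_pser (dcoef (dcoef A)) (psum (dcoef (dcoef A))) :=
  is_pser_psum _ (abs_conv_dcoef _ (abs_conv_dcoef _ habs)).

Let c (k : nat) : C := match k with O => RtoC M | S j => dcoef (dcoef A) j end.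
Let P (z : C) : C := (M + z * psum (dcoef (dcoef A)) z)%C.

Lemma half_plane_pser : is_pser c P.
Proof.
  intros z Hz.
  replace (P z) with (c 0%nat * z ^ 0 + z * psum (dcoef (dcoef A)) z)%C
    by (unfold P; simpl; ring).
  apply (is_series_decr_1_C (fun k => (c k * z ^ k)%C)).
  eapply is_series_ext; [|apply is_series_scal_C; exact (h2 z Hz)].
  intro k. eq_in_C. simpl. ring.
Qed.

Lemma half_plane_nonneg (z : C) : Cmod z < 1 -> 0 <= Re (P z).
Proof.
  intro Hz. unfold P. rewrite re_plus, re_RtoC. pose proof (hpos z Hz). lra.
Qed.

Lemma half_plane_coef_bound (k : nat) :
  Cmod (A (k + 2)%nat) <= 2 * M / (INR (k + 2) * (INR (k + 2) - 1)).
Proof.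
  pose proof (caratheodory_coef_bound c P (S k) half_plane_pser half_plane_nonneg ltac:(lia)) as Hb.
  simpl c in Hb. rewrite re_RtoC in Hb.
  unfold dcoef in Hb. rewrite !Cmod_mult, !Cmod_R, !(Rabs_pos_eq (INR _)) in Hb by apply pos_INR.
  replace (k + 2)%nat with (S (S k)) by lia.
  rewrite (S_INR (S k)) in *.
  pose proof (lt_0_INR (S k) ltac:(lia)) as Hk.
  apply Rle_div_r; [nra|]. 
  replace (INR (S k) + 1 - 1) with (INR (S k)) by ring. lra.
Qed.

Lemma half_plane_second (z : C) :
  Cmod z < 1 -> - (2 * M * Cmod z / (1 + Cmod z)) <= Re (z * psum (dcoef (dcoef A)) z)%C.
Proof.
  intro Hz.
  pose proof (harnack_lower c P z half_plane_pser half_plane_nonneg Hz) as Hh.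
  unfold P in Hh. rewrite re_plus in Hh. simpl c in Hh. rewrite re_RtoC in Hh.
  pose proof (Cmod_ge_0 z).
  replace (- (2 * M * Cmod z / (1 + Cmod z))) with (M * (2 / (1 + Cmod z) - 1) - M)
    by (field; lra).
  lra.
Qed.

Lemma half_plane_first (z : C) :
  Cmod z < 1 -> 1 - 2 * M * ln (1 + Cmod z) <= Re (psum (dcoef A) z).
Proof.
  intro Hz. set (r := Cmod z) in *.
  assert (Hr : 0 <= r) by apply Cmod_ge_0.
  (* Along the ray u z, [q] is Re F' plus the logarithm it is compared with; q(0) = 1, so the claim
     is q(1) >= q(0). *)
  set (q := fun u : R => Re (1 * psum (dcoef A) (0 + u * z))%C + 2 * M * ln (1 + u * r)).
  set (dq := fun u : R => Re (1 * (z * psum (dcoef (dcoef A)) (0 + u * z)))%C + 2 * M * (r / (1 + u * r))).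
  destruct (MVT_cor2 q dq 0 1 ltac:(lra)) as (s & Hs & Hs01).
  { intros u Hu. unfold q, dq.
    apply derivable_pt_lim_plus.
    - apply (pser_derive_line (dcoef A)); [exact h1 | exact h2|].
      rewrite Cplus_0_l. apply Cmod_scal_lt; assumption.
    - apply is_derive_Reals. auto_derive; [nra|]. field. nra. }
  assert (Hdq : 0 <= dq s).
  { unfold dq. rewrite Cmult_1_l, Cplus_0_l.
    assert (Hsz : Cmod (s * z)%C < 1) by (apply Cmod_scal_lt; [lra | assumption]).
    pose proof (half_plane_second (s * z)%C Hsz) as H2.
    rewrite Cmod_mult, Cmod_R, Rabs_pos_eq in H2 by lra. fold r in H2.
    rewrite <- Cmult_assoc, re_scal_l in H2.
    assert (H1s : 0 < 1 + s * r) by nra.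
    (* The bound at s z concerns Re (s z F''(s z)) and so carries a factor s, which cancels because
       the mean value theorem gives s > 0. *)
    assert (E : - (2 * M * (s * r) / (1 + s * r)) = s * - (2 * M * (r / (1 + s * r)))) by (field; lra).
    rewrite E in H2. apply Rmult_le_reg_l in H2; lra. }
  unfold q in Hs.
  replace (0 + 1 * z)%C with z in Hs by ring.
  replace (0 + 0 * z)%C with (RtoC 0) in Hs by ring.
  rewrite (pser_at_0 _ _ h1) in Hs.
  replace (dcoef A 0) with (RtoC 1) in Hs by (unfold dcoef; rewrite hA1; simpl; ring).
  rewrite !Cmult_1_l, Rmult_0_l, Rmult_1_l, Rplus_0_r, ln_1, re_RtoC in Hs.
  lra.
Qed.

(** Pairing with [Cconj z] rather than taking |F| keeps the estimate linear: the u-derivative of Re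
    (conj z F(u z)) is r^2 Re F'(u z), while [lower_growth M] has derivative 1 - 2M ln(1+r). It is
    also the form that expresses outward pointing. *)
Lemma half_plane_growth (z : C) :
  Cmod z < 1 -> Cmod z * lower_growth M (Cmod z) <= Re (Cconj z * F z)%C.
Proof.
  intro Hz. set (r := Cmod z) in *.
  assert (Hr : 0 <= r) by apply Cmod_ge_0.
  set (q := fun u : R => Re (Cconj z * F (0 + u * z))%C - r * lower_growth M (u * r)).
  set (dq := fun u : R => Re (Cconj z * (z * psum (dcoef A) (0 + u * z)))%C
                     - r * (r * (1 - 2 * M * ln (1 + u * r)))).
  destruct (MVT_cor2 q dq 0 1 ltac:(lra)) as (s & Hs & Hs01).
  { intros u Hu. unfold q, dq.
    apply derivable_pt_lim_minus.
    - apply (pser_derive_line A); [exact hF | exact h1|].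
      rewrite Cplus_0_l. apply Cmod_scal_lt; assumption.
    - apply is_derive_Reals. unfold lower_growth. auto_derive; [nra|]. field. nra. }
  assert (Hdq : 0 <= dq s).
  { unfold dq. rewrite Cplus_0_l.
    assert (Hsz : Cmod (s * z)%C < 1) by (apply Cmod_scal_lt; [lra | assumption]).
    pose proof (half_plane_first (s * z)%C Hsz) as H1.
    rewrite Cmod_mult, Cmod_R, Rabs_pos_eq in H1 by lra. fold r in H1.
    replace (Cconj z * (z * psum (dcoef A) (s * z)))%C
      with ((z * Cconj z) * psum (dcoef A) (s * z))%C by ring.
    rewrite <- Cmod2_conj. fold r. rewrite re_scal_l.
    pose proof (pow2_ge_0 r). nra. }
  unfold q in Hs.
  replace (0 + 1 * z)%C with z in Hs by ring.
  replace (0 + 0 * z)%C with (RtoC 0) in Hs by ring.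
  rewrite (pser_at_0 _ _ hF), hA0 in Hs.
  rewrite Cmult_0_r, re_RtoC, Rmult_1_l, Rmult_0_l in Hs.
  unfold lower_growth at 2 in Hs. rewrite Rplus_0_r, ln_1 in Hs.
  lra.
Qed.

End HalfPlane.

(** * Winding numbers and the covering theorem *)

(** Used in both variables: along rho with [a], [b] the t-derivatives of the coordinates, along t
    with the rho-derivatives. *)
Lemma is_derive_angle_form (p q a b : R -> R) (x p' q' a' b' : R) :
  is_derive p x p' -> is_derive q x q' -> is_derive a x a' -> is_derive b x b' ->
  p x * p x + q x * q x <> 0 ->
  is_derive (fun s => (p s * b s - q s * a s) / (p s * p s + q s * q s)) x
    (((p' * b x + p x * b' - q' * a x - q x * a') * (p x * p x + q x * q x)
      - (p x * b x - q x * a x) * (2 * p x * p' + 2 * q x * q'))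
     / (p x * p x + q x * q x) ^ 2).
Proof.
  intros Hp Hq Ha Hb HN.
  auto_derive.
  - repeat split; try (eexists; eassumption). exact HN.
  - rewrite (is_derive_unique (fun s : R => p s : R) _ _ Hp), (is_derive_unique (fun s : R => q s : R) _ _ Hq),
      (is_derive_unique (fun s : R => a s : R) _ _ Ha), (is_derive_unique (fun s : R => b s : R) _ _ Hb).
    field. exact HN.
Qed.

(* [P] is C^2 in the polar coordinates (rho, t), where negative rho are
   allowed so that the centre of the disk is an interior parameter. *)
Definition polar_C2 (P Pr Pt Prt : R -> R -> R) : Prop :=
  forall rho t : R, Rabs rho < 1 ->
    (is_derive (fun x => P x t) rho (Pr rho t) /\
     is_derive (fun y => P rho y) t (Pt rho t) /\
     is_derive (fun x => Pt x t) rho (Prt rho t) /\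
     is_derive (fun y => Pr rho y) t (Prt rho t)) /\
    (continuity_2d_pt P rho t /\ continuity_2d_pt Pr rho t /\
     continuity_2d_pt Pt rho t /\ continuity_2d_pt Prt rho t).

Lemma continuity_2d_section (f : R -> R -> R) (x t : R) :
  continuity_2d_pt f x t -> continuous (fun s => f x s) t.
Proof.
  intro Hf. apply continuity_2d_pt_filterlim in Hf.
  apply (continuous_comp_2 (fun _ => x) (fun s => s) f t);
    [apply continuous_const | apply continuous_id | exact Hf].
Qed.

Lemma locally_Rabs_lt_1 (x : R) : Rabs x < 1 -> locally x (fun y => Rabs y < 1).
Proof.
  intro Hx. assert (He : 0 < 1 - Rabs x) by lra.
  assert (Hy : forall y : R, Rabs (y - x) < 1 - Rabs x -> Rabs y < 1).
  { intros y Hy. pose proof (Rabs_triang (y - x) x) as Ht.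
    replace (y - x + x) with y in Ht by ring. lra. }
  exists (mkposreal _ He). exact Hy.
Qed.

Section Winding.

Variables P Pr Pt Prt Q Qr Qt Qrt : R -> R -> R.
Hypothesis hP : polar_C2 P Pr Pt Prt.
Hypothesis hQ : polar_C2 Q Qr Qt Qrt.
Hypothesis hN : forall rho t, Rabs rho < 1 -> P rho t * P rho t + Q rho t * Q rho t <> 0.
Hypothesis hper : forall rho, P rho (2 * PI) = P rho 0 /\ Q rho (2 * PI) = Q rho 0
  /\ Pr rho (2 * PI) = Pr rho 0 /\ Qr rho (2 * PI) = Qr rho 0.
Hypothesis hcenter : forall t, Pt 0 t = 0 /\ Qt 0 t = 0.

(** [f] and [k] are the dt and d rho coefficients of d arg(P + iQ), and [D] is their common cross
    derivative. *)
Let f rho t := (P rho t * Qt rho t - Q rho t * Pt rho t)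
               / (P rho t * P rho t + Q rho t * Q rho t).
Let k rho t := (P rho t * Qr rho t - Q rho t * Pr rho t)
               / (P rho t * P rho t + Q rho t * Q rho t).
Let D rho t :=
  (((Pr rho t * Qt rho t + P rho t * Qrt rho t - Qr rho t * Pt rho t - Q rho t * Prt rho t)
      * (P rho t * P rho t + Q rho t * Q rho t)
    - (P rho t * Qt rho t - Q rho t * Pt rho t) * (2 * P rho t * Pr rho t + 2 * Q rho t * Qr rho t))
   / (P rho t * P rho t + Q rho t * Q rho t) ^ 2).

Lemma angle_form_derive_rho rho t : Rabs rho < 1 -> is_derive (fun x => f x t) rho (D rho t).
Proof.
  intro Hr. destruct (hP rho t Hr) as [(H1 & H2 & H3 & H4) _].
  destruct (hQ rho t Hr) as [(K1 & K2 & K3 & K4) _].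
  exact (is_derive_angle_form (fun x => P x t) (fun x => Q x t) (fun x => Pt x t) (fun x => Qt x t)
    rho _ _ _ _ H1 K1 H3 K3 (hN rho t Hr)).
Qed.

(* The form d arg(P + iQ) is closed. *)
Lemma angle_form_derive_t rho t : Rabs rho < 1 -> is_derive (fun y => k rho y) t (D rho t).
Proof.
  intro Hr. destruct (hP rho t Hr) as [(H1 & H2 & H3 & H4) _].
  destruct (hQ rho t Hr) as [(K1 & K2 & K3 & K4) _].
  pose proof (is_derive_angle_form (P rho) (Q rho) (Pr rho) (Qr rho)
    t _ _ _ _ H2 K2 H4 K4 (hN rho t Hr)) as HD.
  match type of HD with is_derive _ _ ?v => replace (D rho t) with v; [exact HD|] end.
  unfold D. field. exact (hN rho t Hr).
Qed.

Lemma continuity_2d_angle_form rho t : Rabs rho < 1 -> continuity_2d_pt f rho t.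
Proof.
  intro Hr. destruct (hP rho t Hr) as [_ (H1 & H2 & H3 & H4)].
  destruct (hQ rho t Hr) as [_ (K1 & K2 & K3 & K4)].
  unfold f, Rdiv.
  repeat first [assumption | apply continuity_2d_pt_mult | apply continuity_2d_pt_minus
    | apply continuity_2d_pt_plus | apply continuity_2d_pt_inv; [|exact (hN rho t Hr)]].
Qed.

Lemma continuity_2d_angle_form_derive rho t : Rabs rho < 1 -> continuity_2d_pt D rho t.
Proof.
  intro Hr. destruct (hP rho t Hr) as [_ (H1 & H2 & H3 & H4)].
  destruct (hQ rho t Hr) as [_ (K1 & K2 & K3 & K4)].
  unfold D, Rdiv.
  apply continuity_2d_pt_mult.
  - repeat first [assumption | apply continuity_2d_pt_const | apply continuity_2d_pt_mult
      | apply continuity_2d_pt_minus | apply continuity_2d_pt_plus].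
  - apply continuity_2d_pt_inv; [|apply pow_nonzero; exact (hN rho t Hr)].
    simpl. repeat first [assumption | apply continuity_2d_pt_const | apply continuity_2d_pt_mult
      | apply continuity_2d_pt_plus].
Qed.

(** Differentiating under the integral gives the integral of [D], which is also the t-derivative of
    [k]; over a period this is k(2 PI) - k(0) = 0. *)
Lemma winding_integral_derive rho :
  Rabs rho < 1 -> is_derive (fun x => RInt (fun t => f x t) 0 (2 * PI)) rho 0.
Proof.
  intro Hr.
  assert (Hloc := locally_Rabs_lt_1 rho Hr).
  assert (E : RInt (fun t => Derive (fun u => f u t) rho) 0 (2 * PI) = 0).
  { apply is_RInt_unique.
    apply is_RInt_ext with (D rho).
    { intros t _. symmetry. apply is_derive_unique. exact (angle_form_derive_rho rho t Hr). }
    assert (E : minus (k rho (2 * PI)) (k rho 0) = 0).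
    { unfold k. destruct (hper rho) as (-> & -> & -> & ->).
      unfold minus, plus, opp. simpl. ring. }
    refine (eq_ind _ (fun v => is_RInt _ 0 (2 * PI) v) _ _ E).
    apply (is_RInt_derive (V := R_CompleteNormedModule)).
    - intros t _. exact (angle_form_derive_t rho t Hr).
    - intros t _. apply continuity_2d_section. exact (continuity_2d_angle_form_derive rho t Hr). }
  refine (eq_ind _ (fun v => is_derive _ rho v) _ _ E).
  apply (is_derive_RInt_param f).
  - revert Hloc. apply filter_imp. intros x Hx t _. exists (D x t).
    exact (angle_form_derive_rho x t Hx).
  - intros t _. apply continuity_2d_pt_ext_loc with D.
    + destruct Hloc as [e He]. exists e. intros u v Hu _.
      symmetry. apply is_derive_unique. apply angle_form_derive_rho. apply He. exact Hu.
    + exact (continuity_2d_angle_form_derive rho t Hr).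
  - revert Hloc. apply filter_imp. intros x Hx.
    apply (@ex_RInt_continuous R_CompleteNormedModule). intros t _.
    apply continuity_2d_section. exact (continuity_2d_angle_form x t Hx).
Qed.

(** The circle shrinks to the centre without changing the integral, and there the t-derivatives
    vanish, hence so does the integrand. *)
Lemma winding_integral_zero r : 0 < r < 1 -> RInt (fun t => f r t) 0 (2 * PI) = 0.
Proof.
  intro Hr.
  destruct (MVT_cor2 (fun x => RInt (fun t => f x t) 0 (2 * PI)) (fun _ => 0) 0 r ltac:(lra))
    as (s & Hs & _).
  { intros x Hx. apply is_derive_Reals. apply winding_integral_derive.
    rewrite Rabs_pos_eq; lra. }
  assert (H0 : RInt (fun t => f 0 t) 0 (2 * PI) = 0).
  { rewrite (RInt_ext _ (fun _ => 0)).
    - rewrite RInt_const. apply Rmult_0_r.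
    - intros t _. unfold f. destruct (hcenter t) as [-> ->].
      rewrite !Rmult_0_r, Rminus_diag. apply Rdiv_0_l. }
  rewrite H0 in Hs. lra.
Qed.

(* If P + iQ points outward along the circle, its argument minus t stays in
   (-pi/2, pi/2), so the winding integral is 2 pi. *)
Lemma winding_integral_outward r :
  0 < r < 1 -> (forall t, 0 < P r t * cos t + Q r t * sin t) ->
  RInt (fun t => f r t) 0 (2 * PI) = 2 * PI.
Proof.
  intros Hr Hout.
  assert (Hr1 : Rabs r < 1) by (rewrite Rabs_pos_eq; lra).
  set (theta := fun t => t + atan ((Q r t * cos t - P r t * sin t) / (P r t * cos t + Q r t * sin t))).
  assert (E : minus (theta (2 * PI)) (theta 0) = 2 * PI).
  { unfold theta. destruct (hper r) as (-> & -> & _).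
    rewrite cos_2PI, sin_2PI, cos_0, sin_0. unfold minus, plus, opp. simpl. ring. }
  apply is_RInt_unique.
  refine (eq_ind _ (fun v => is_RInt _ 0 (2 * PI) v) _ _ E).
  apply (is_RInt_derive (V := R_CompleteNormedModule)).
  - intros t _.
    destruct (hP r t Hr1) as [(_ & H2 & _) _].
    destruct (hQ r t Hr1) as [(_ & K2 & _) _].
    specialize (Hout t).
    unfold theta. auto_derive.
    + repeat split; try (eexists; eassumption). lra.
    + rewrite (is_derive_unique (fun x : R => P r x : R) _ _ H2), (is_derive_unique (fun x : R => Q r x : R) _ _ K2).
      unfold f.
      pose proof (sin2_cos2 t) as Hsc. unfold Rsqr in Hsc.
      pose proof (hN r t Hr1) as HN.
      set (p := P r t) in *. set (q := Q r t) in *. set (p' := Pt r t). set (q' := Qt r t).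
      set (co := cos t) in *. set (si := sin t) in *.
      (* The two squares on the right are the coordinates of P + iQ in the frame rotated by t, so
         the length is the same; theta is t plus the atan of their quotient. *)
      assert (EN : p * p + q * q = (p * co + q * si) * (p * co + q * si) + (q * co - p * si) * (q * co - p * si)).
      { transitivity ((p * p + q * q) * (si * si + co * co)); [rewrite Hsc|]; ring. }
      assert (HU : p * co + q * si <> 0) by lra.
      rewrite EN in *.
      set (U := p * co + q * si) in *. set (V := q * co - p * si) in *.
      transitivity (1 + ((q' * co - q * si - p' * si - p * co) * U
                         - V * (p' * co - p * si + q' * si + q * co)) / (U * U + V * V)).
      { change (q * co + - (p * si)) with V. clearbody U V. field. split; assumption. }
      replace (p * q' - q * p') with ((p * q' - q * p') * (si * si + co * co))
        by (rewrite Hsc; ring).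
      unfold U, V in *. field. exact HN.
  - intros t _. apply continuity_2d_section. exact (continuity_2d_angle_form r t Hr1).
Qed.

End Winding.

(** * Power series in polar coordinates and the covering theorem *)

Lemma Cmod_polar (rho t : R) : Cmod (rho * cos t, rho * sin t) = Rabs rho.
Proof.
  replace (rho * cos t, rho * sin t) with (RtoC rho * cis t)%C
    by (unfold cis, RtoC, Cmult; simpl; f_equal; ring).
  rewrite Cmod_mult, Cmod_cis, Cmod_R. ring.
Qed.

(** Multiplication by e^(it) is expanded into real parts with factors [xi] and [Ci * xi], so the
    derivatives are built from functions of the same kind and the lemma can be applied again to
    them. *)
Lemma pser_polar_differentiable (c : nat -> C) (H H' : C -> C) (xi : C) (rho t : R) :
  is_pser c H -> is_pser (dcoef c) H' -> Rabs rho < 1 ->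
  differentiable_pt_lim (fun u v => Re (xi * H (u * cos v, u * sin v)%R)%C) rho t
    (cos t * Re (xi * H' (rho * cos t, rho * sin t)%R)%C
     + sin t * Re (Ci * xi * H' (rho * cos t, rho * sin t)%R)%C)
    (rho * (cos t * Re (Ci * xi * H' (rho * cos t, rho * sin t)%R)%C
            - sin t * Re (xi * H' (rho * cos t, rho * sin t)%R)%C)).
Proof.
  intros Hc Hd Hr.
  assert (Hz : Cmod (rho * cos t, rho * sin t) < 1) by now rewrite Cmod_polar.
  assert (Hdiff : forall (f f' : R -> R), (forall s, derivable_pt_lim f s (f' s)) ->
    differentiable_pt_lim (fun u v => u * f v) rho t (f t) (rho * f' t)).
  { intros f f' Hf. apply (differentiable_pt_lim_ext (fun u v => (fun a b => a * b) u (f v))).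
    { exists (mkposreal 1 Rlt_0_1). reflexivity. }
    pose proof (differentiable_pt_lim_comp (fun a b => a * b) (fun u _ => u) (fun _ v => f v) rho t
      (f t) rho 1 0 0 (f' t)) as HD.
    replace (f t) with (f t * 1 + rho * 0) at 1 by ring.
    replace (rho * f' t) with (f t * 0 + rho * f' t) by ring.
    apply HD.
    - intro eps. exists eps. intros u v Hu Hv.
      replace (u * v - rho * f t - (f t * (u - rho) + rho * (v - f t)))
        with ((u - rho) * (v - f t)) by ring.
      rewrite Rabs_mult.
      apply Rmult_le_compat; try apply Rabs_pos; [lra | apply Rmax_r].
    - intro eps. exists eps. intros u v _ _.
      replace (u - rho - (1 * (u - rho) + 0 * (v - t))) with 0 by ring.
      rewrite Rabs_R0. apply Rmult_le_pos; [left; apply cond_pos|].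
      eapply Rle_trans; [apply Rabs_pos | apply Rmax_l].
    - apply filterdiff_differentiable_pt_lim.
      apply filterdiff_ext_lin with (fun u : R * R => (fun y => scal y (f' t)) (snd u)).
      + apply (filterdiff_comp' (fun u : R * R => snd u) f (rho, t) snd (fun y => scal y (f' t))).
        * apply filterdiff_linear, is_linear_snd.
        * apply is_derive_Reals. apply Hf.
      + intros [a b]. simpl. unfold scal; simpl; unfold mult; simpl. ring. }
  pose proof (differentiable_pt_lim_comp (fun u v => Re (xi * H (u, v))%C)
    (fun u v => u * cos v) (fun u v => u * sin v) rho t _ _ _ _ _ _
    (pser_differentiable c H H' xi _ _ Hc Hd Hz)
    (Hdiff cos (fun s => - sin s) derivable_pt_lim_cos)
    (Hdiff sin cos derivable_pt_lim_sin)) as HD.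
  match type of HD with differentiable_pt_lim _ _ _ ?a ?b =>
    match goal with |- differentiable_pt_lim _ _ _ ?a' ?b' =>
      replace a' with a; [replace b' with b; [exact HD|]|] end end;
  unfold Re, Cmult, Ci; simpl; ring.
Qed.

Lemma differentiable_polar_partials (f : R -> R -> R) (x y lx ly : R) :
  differentiable_pt_lim f x y lx ly ->
  is_derive (fun u => f u y) x lx /\ is_derive (fun v => f x v) y ly /\ continuity_2d_pt f x y.
Proof.
  intro Hf. split; [|split].
  - apply is_derive_Reals.
    pose proof (derivable_pt_lim_comp_2d f (fun u => u) (fun _ => y) x lx ly 1 0 Hf
      (derivable_pt_lim_id x) (derivable_pt_lim_const y x)) as HD.
    replace (lx * 1 + ly * 0) with lx in HD by ring. exact HD.
  - apply is_derive_Reals.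
    pose proof (derivable_pt_lim_comp_2d f (fun _ => x) (fun v => v) y lx ly 0 1 Hf
      (derivable_pt_lim_const x y) (derivable_pt_lim_id y)) as HD.
    replace (lx * 0 + ly * 1) with ly in HD by ring. exact HD.
  - apply differentiable_continuity_pt. exists lx, ly. exact Hf.
Qed.

Lemma continuity_2d_pt_fun_snd (f : R -> R) (x y : R) :
  continuity f -> continuity_2d_pt (fun _ v => f v) x y.
Proof.
  intro Hf. apply (continuity_1d_2d_pt_comp f (fun _ v => v)).
  - apply Hf.
  - apply continuity_2d_pt_id2.
Qed.

Lemma is_derive_minus_const (f : R -> R) (x l kappa : R) :
  is_derive f x l -> is_derive (fun s => f s - kappa) x l.
Proof.
  intro Hf. replace l with (minus l 0) by (unfold minus, plus, opp; simpl; ring).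
  apply (@is_derive_minus R_AbsRing R_NormedModule f (fun _ => kappa)); [exact Hf|].
  apply (@is_derive_const R_AbsRing R_NormedModule).
Qed.

Section PolarPser.

Variables (c : nat -> C) (H : C -> C).
Hypothesis hH : is_pser c H.
Variable (xi : C) (kappa : R).

Let hc : abs_conv c := is_pser_abs_conv c H hH.
Let hc1 := abs_conv_dcoef _ hc.
Let hc2 := abs_conv_dcoef _ hc1.
Let h1 := is_pser_psum _ hc1.
Let h2 := is_pser_psum _ hc2.
Let h3 := is_pser_psum _ (abs_conv_dcoef _ hc2).

Let a1 r t := Re (xi * psum (dcoef c) (r * cos t, r * sin t)%R)%C.
Let b1 r t := Re (Ci * xi * psum (dcoef c) (r * cos t, r * sin t)%R)%C.
Let a2 r t := Re (xi * psum (dcoef (dcoef c)) (r * cos t, r * sin t)%R)%C.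
Let b2 r t := Re (Ci * xi * psum (dcoef (dcoef c)) (r * cos t, r * sin t)%R)%C.

(** With xi = 1 or -i and kappa the matching coordinate of w, these are a coordinate of f - w and
    its polar derivatives. *)
Definition polar_part (rho t : R) : R := Re (xi * H (rho * cos t, rho * sin t)%R)%C - kappa.
Definition polar_part_r (rho t : R) : R := cos t * a1 rho t + sin t * b1 rho t.
Definition polar_part_t (rho t : R) : R := rho * (cos t * b1 rho t - sin t * a1 rho t).
Definition polar_part_rt (rho t : R) : R :=
  (cos t * b1 rho t - sin t * a1 rho t)
  + rho * (cos t * (cos t * b2 rho t - sin t * a2 rho t)
           - sin t * (cos t * a2 rho t + sin t * b2 rho t)).

Lemma polar_part_C2 : polar_C2 polar_part polar_part_r polar_part_t polar_part_rt.
Proof.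
  intros rho t Hr.
  destruct (differentiable_polar_partials _ _ _ _ _
    (pser_polar_differentiable c H _ xi rho t hH h1 Hr)) as (D0r & D0t & C0).
  destruct (differentiable_polar_partials _ _ _ _ _
    (pser_polar_differentiable _ _ _ xi rho t h1 h2 Hr)) as (D1r & D1t & C1).
  destruct (differentiable_polar_partials _ _ _ _ _
    (pser_polar_differentiable _ _ _ (Ci * xi)%C rho t h1 h2 Hr)) as (E1r & E1t & CE1).
  destruct (differentiable_polar_partials _ _ _ _ _
    (pser_polar_differentiable _ _ _ xi rho t h2 h3 Hr)) as (_ & _ & C2).
  destruct (differentiable_polar_partials _ _ _ _ _
    (pser_polar_differentiable _ _ _ (Ci * xi)%C rho t h2 h3 Hr)) as (_ & _ & CE2).
  (* A second factor i only produces a sign, so the [a] and [b] families are closed under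
     differentiation. *)
  assert (Hii : forall x, Re (Ci * (Ci * xi) * x)%C = - Re (xi * x)%C).
  { intro x. unfold Re, Cmult, Ci. simpl. ring. }
  rewrite Hii in E1r, E1t.
  change (is_derive (fun u => a1 u t) rho (cos t * a2 rho t + sin t * b2 rho t)) in D1r.
  change (is_derive (fun v => a1 rho v) t (rho * (cos t * b2 rho t - sin t * a2 rho t))) in D1t.
  change (is_derive (fun u => b1 u t) rho (cos t * b2 rho t + sin t * - a2 rho t)) in E1r.
  change (is_derive (fun v => b1 rho v) t (rho * (cos t * - a2 rho t - sin t * b2 rho t))) in E1t.
  change (continuity_2d_pt a1 rho t) in C1.
  change (continuity_2d_pt b1 rho t) in CE1.
  change (continuity_2d_pt a2 rho t) in C2.
  change (continuity_2d_pt b2 rho t) in CE2.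
  assert (Ccos := continuity_2d_pt_fun_snd cos rho t continuity_cos).
  assert (Csin := continuity_2d_pt_fun_snd sin rho t continuity_sin).
  assert (Cid := continuity_2d_pt_id1 rho t).
  split; [|refine (conj _ (conj _ (conj _ _)))].
  - refine (conj _ (conj _ (conj _ _))).
    + apply (is_derive_minus_const (fun x => Re (xi * H (x * cos t, x * sin t)%R)%C)). exact D0r.
    + apply (is_derive_minus_const (fun y => Re (xi * H (rho * cos y, rho * sin y)%R)%C)). exact D0t.
    + unfold polar_part_t. auto_derive; [repeat split; eexists; eassumption|].
      rewrite (is_derive_unique (fun u : R => a1 u t : R) _ _ D1r),
        (is_derive_unique (fun u : R => b1 u t : R) _ _ E1r).
      unfold polar_part_rt. ring.
    + unfold polar_part_r. auto_derive; [repeat split; eexists; eassumption|].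
      rewrite (is_derive_unique (fun u : R => a1 rho u : R) _ _ D1t),
        (is_derive_unique (fun u : R => b1 rho u : R) _ _ E1t).
      unfold polar_part_rt. ring.
  - apply continuity_2d_pt_minus; [exact C0 | apply continuity_2d_pt_const].
  - unfold polar_part_r.
    repeat first [assumption | apply continuity_2d_pt_mult | apply continuity_2d_pt_minus
      | apply continuity_2d_pt_plus].
  - unfold polar_part_t.
    repeat first [assumption | apply continuity_2d_pt_mult | apply continuity_2d_pt_minus
      | apply continuity_2d_pt_plus].
  - unfold polar_part_rt.
    repeat first [assumption | apply continuity_2d_pt_mult | apply continuity_2d_pt_minus
      | apply continuity_2d_pt_plus].
Qed.

Lemma polar_part_periodic (rho : R) :
  polar_part rho (2 * PI) = polar_part rho 0 /\ polar_part_r rho (2 * PI) = polar_part_r rho 0.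
Proof.
  unfold polar_part, polar_part_r, a1, b1.
  rewrite cos_2PI, sin_2PI, cos_0, sin_0. split; reflexivity.
Qed.

Lemma polar_part_t_center (t : R) : polar_part_t 0 t = 0.
Proof. unfold polar_part_t. ring. Qed.

End PolarPser.

(** Re f = Re (h + g) and Im f = Im (h - g): each coordinate of f - w comes from one analytic
    function, so the polar calculus of power series applies. If w were omitted, the winding integral
    would be both 0 and 2 PI. *)
Lemma harmonic_covering (a b : nat -> C) (h g : C -> C) (w : C) (r : R) :
  is_pser a h -> is_pser b g -> 0 < r < 1 ->
  (forall z, Cmod z = r -> 0 < Re (Cconj z * (h z + Cconj (g z) - w))%C) ->
  exists z, Cmod z < 1 /\ (h z + Cconj (g z))%C = w.
Proof.
  intros Ha Hb Hr Hout.
  apply NNPP. intro Hno.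
  set (hs := fun z => (h z + g z)%C).
  set (hd := fun z => (h z - g z)%C).
  assert (Hs : is_pser (fun k => (a k + b k)%C) hs).
  { intros z Hz. eapply is_series_ext; [|apply is_series_plus_C; [exact (Ha z Hz) | exact (Hb z Hz)]].
    intro k. eq_in_C. simpl. ring. }
  assert (Hd : is_pser (fun k => (a k - b k)%C) hd).
  { intros z Hz. eapply is_series_ext;
      [|apply is_series_plus_C; [exact (Ha z Hz) | exact (is_series_opp_C _ _ (Hb z Hz))]].
    intro k. eq_in_C. simpl. ring. }
  set (P := polar_part hs 1 (Re w)).
  set (Q := polar_part hd (- Ci) (Im w)).
  assert (HPQ : forall rho t,
    (h (rho * cos t, rho * sin t)%R + Cconj (g (rho * cos t, rho * sin t)%R) - w)%C = (P rho t, Q rho t)).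
  { intros rho t. unfold P, Q, polar_part, hs, hd.
    set (x := h _). set (y := g _).
    unfold Cminus, Cplus, Cmult, Copp, Cconj, Re, Im, Ci, RtoC. simpl. f_equal; ring. }
  assert (HN : forall rho t, Rabs rho < 1 -> P rho t * P rho t + Q rho t * Q rho t <> 0).
  { intros rho t Hrho HN. apply Hno. exists (rho * cos t, rho * sin t).
    split; [now rewrite Cmod_polar|].
    pose proof (Rle_0_sqr (P rho t)) as HP0. pose proof (Rle_0_sqr (Q rho t)) as HQ0.
    unfold Rsqr in HP0, HQ0.
    assert (EP : P rho t = 0) by (apply Rsqr_0_uniq; unfold Rsqr; lra).
    assert (EQ : Q rho t = 0) by (apply Rsqr_0_uniq; unfold Rsqr; lra).
    specialize (HPQ rho t). rewrite EP, EQ in HPQ.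
    change (0, 0) with (RtoC 0) in HPQ.
    match goal with |- ?x = w => replace x with (x - w + w)%C by ring end.
    rewrite HPQ. ring. }
  assert (Hper : forall rho, P rho (2 * PI) = P rho 0 /\ Q rho (2 * PI) = Q rho 0
    /\ polar_part_r (fun k => (a k + b k)%C) 1 rho (2 * PI)
       = polar_part_r (fun k => (a k + b k)%C) 1 rho 0
    /\ polar_part_r (fun k => (a k - b k)%C) (- Ci) rho (2 * PI)
       = polar_part_r (fun k => (a k - b k)%C) (- Ci) rho 0).
  { intro rho.
    destruct (polar_part_periodic (fun k => (a k + b k)%C) hs 1 (Re w) rho).
    destruct (polar_part_periodic (fun k => (a k - b k)%C) hd (- Ci) (Im w) rho).
    repeat split; assumption. }
  assert (Hcen : forall t, polar_part_t (fun k => (a k + b k)%C) 1 0 t = 0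
     /\ polar_part_t (fun k => (a k - b k)%C) (- Ci) 0 t = 0).
  { intro t. split; apply polar_part_t_center. }
  pose proof (polar_part_C2 _ _ Hs 1 (Re w)) as HP2. fold P in HP2.
  pose proof (polar_part_C2 _ _ Hd (- Ci) (Im w)) as HQ2. fold Q in HQ2.
  pose proof (winding_integral_zero _ _ _ _ _ _ _ _ HP2 HQ2 HN Hper Hcen r Hr) as W0.
  assert (Hpos : forall t, 0 < P r t * cos t + Q r t * sin t).
  { intro t.
    specialize (Hout (r * cos t, r * sin t)).
    rewrite Cmod_polar, Rabs_pos_eq in Hout by lra. specialize (Hout eq_refl).
    rewrite HPQ in Hout. unfold Cconj, Cmult, Re in Hout. simpl in Hout.
    apply Rmult_lt_reg_l with r; lra. }
  pose proof (winding_integral_outward _ _ _ _ _ _ _ _ HP2 HQ2 HN Hper r Hr Hpos) as W1.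
  pose proof (eq_trans (eq_sym W1) W0). pose proof PI_RGT_0. lra.
Qed.

(** * The radius equation *)

(** The polynomial s(u) - ln(1+u) has derivative of modulus u^(N+1)/(1+u), at most u^(N+1), whose
    integral over [0,1] is the error bound 1/(N+2). *)
Lemma ln_2_alternating : is_lim_seq (sum_n (fun k => (-1) ^ k / (INR k + 1))) (ln 2).
Proof.
  assert (Hb : forall N, Rabs (sum_n (fun k => (-1) ^ k / (INR k + 1)) N - ln 2) <= / (INR N + 2)).
  { intro N. pose proof (pos_INR N) as HN.
    set (s := fun u => sum_n (fun k => (-1) ^ k / (INR k + 1) * u ^ S k) N).
    set (ds := fun u => sum_n (fun k => (- u) ^ k) N).
    assert (Hterm : forall n u, is_derive (fun t => (-1) ^ n / (INR n + 1) * t ^ S n) u ((- u) ^ n)).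
    { intros n u. pose proof (pos_INR n).
      replace (- u) with (-1 * u) by ring. rewrite Rpow_mult_distr.
      replace ((-1) ^ n * u ^ n) with ((-1) ^ n / (INR n + 1) * (INR (S n) * 1 * u ^ n))
        by (rewrite S_INR; field; lra).
      apply is_derive_scal.
      apply (is_derive_pow (fun t => t) (S n) u 1). apply (@is_derive_id R_AbsRing). }
    assert (Hs : forall u, is_derive s u (ds u)).
    { intro u. unfold s, ds. clear HN. induction N as [|N IH].
      - rewrite sum_O. apply (is_derive_ext (fun t => (-1) ^ 0 / (INR 0 + 1) * t ^ 1)); [intro t; symmetry; apply sum_O|].
        apply Hterm.
      - rewrite sum_Sn.
        apply (is_derive_ext (fun t => plus (sum_n (fun k => (-1) ^ k / (INR k + 1) * t ^ S k) N)
            ((-1) ^ S N / (INR (S N) + 1) * t ^ S (S N)))); [intro t; symmetry; apply sum_Sn|].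
        apply (@is_derive_plus R_AbsRing R_NormedModule); [exact IH | apply Hterm]. }
    assert (Hgeom : forall u, 0 <= u -> ds u = / (1 + u) - (- u) ^ S N / (1 + u)).
    { intros u Hu. unfold ds. clear HN s ds Hs. induction N as [|N IH].
      - rewrite sum_O. simpl. field. lra.
      - rewrite sum_Sn, IH. unfold plus. simpl. field. lra. }
    assert (Hpow : forall u, 0 <= u -> Rabs ((- u) ^ S N / (1 + u)) <= u ^ S N).
    { intros u Hu. unfold Rdiv. rewrite Rabs_mult, <- RPow_abs, Rabs_Ropp, Rabs_pos_eq by exact Hu.
      rewrite Rabs_pos_eq by (left; apply Rinv_0_lt_compat; lra).
      rewrite <- (Rmult_1_r (u ^ S N)) at 2.
      apply Rmult_le_compat_l; [apply pow_le; exact Hu|].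
      rewrite <- Rinv_1. apply Rinv_le_contravar; lra. }
    (* The sign [sg] lets one mean value argument give the upper and the lower bound. *)
    assert (Hmono : forall sg, sg = 1 \/ sg = -1 ->
       sg * (s 1 - ln 2) <= / (INR N + 2)).
    { intros sg Hsg.
      destruct (MVT_cor2 (fun u => / (INR N + 2) * u ^ S (S N) - sg * (s u - ln (1 + u)))
        (fun u => u ^ S N - sg * (ds u - / (1 + u))) 0 1 ltac:(lra)) as (v & Hv & Hv1).
      { intros u Hu. apply derivable_pt_lim_minus.
        - apply is_derive_Reals. auto_derive; [exact I|].
          replace (match N with 0%nat => 1 | S _ => INR N + 1 end + 1) with (INR N + 2)
            by (destruct N; simpl; ring).
          simpl. field. lra.
        - apply is_derive_Reals.
          apply (is_derive_scal (fun t => s t - ln (1 + t))).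
          apply (@is_derive_minus R_AbsRing R_NormedModule s (fun t => ln (1 + t))); [apply Hs|].
          auto_derive; [lra|]. field. lra. }
      assert (H0 : s 0 = 0).
      { unfold s. rewrite (sum_n_ext _ (fun _ => 0)).
        - rewrite sum_n_const. apply Rmult_0_r.
        - intro k. simpl. ring. }
      cbv beta in Hv. rewrite H0, Rplus_0_r, ln_1, pow1 in Hv.
      replace (1 + 1) with 2 in Hv by ring.
      rewrite Hgeom in Hv by lra.
      pose proof (Hpow v ltac:(lra)) as Hp. apply Rabs_le_between in Hp.
      simpl pow in Hv. rewrite Rmult_0_l, Rmult_0_r in Hv.
      simpl pow in Hp.
      destruct Hsg as [-> | ->]; nra. }
    assert (Hs1 : s 1 = sum_n (fun k => (-1) ^ k / (INR k + 1)) N).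
    { unfold s. apply sum_n_ext. intro k. rewrite pow1. apply Rmult_1_r. }
    rewrite <- Hs1. apply Rabs_le.
    pose proof (Hmono 1 (or_introl eq_refl)). pose proof (Hmono (-1) (or_intror eq_refl)). lra. }
  apply is_lim_seq_spec. intro eps.
  destruct (nfloor_ex (/ eps)) as [n Hn].
  { left. apply Rinv_0_lt_compat, cond_pos. }
  exists n. intros m Hm.
  eapply Rle_lt_trans; [apply Hb|].
  apply le_INR in Hm. pose proof (cond_pos eps) as He.
  rewrite <- (Rinv_inv eps). apply Rinv_lt_contravar.
  - apply Rmult_lt_0_compat; [apply Rinv_0_lt_compat; exact He|]. pose proof (pos_INR m). lra.
  - lra.
Qed.

(** Splitting 1/(n(n-1)) as 1/(n-1) - 1/n yields two shifted copies of the alternating harmonic sum;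
    the closed form of the partial sums below records this with its boundary term. *)
Lemma Series2_alternating :
  Series2 (fun n => (-1) ^ (n - 1) / (INR n * (INR n - 1))) = 1 - 2 * ln 2.
Proof.
  unfold Series2. apply is_series_unique.
  match goal with |- is_series ?u ?l => change (is_lim_seq (sum_n u) l) end.
  apply is_lim_seq_ext with
    (fun N => 1 - 2 * sum_n (fun k => (-1) ^ k / (INR k + 1)) N + (-1) ^ N * / (INR N + 2)).
  - intro N. induction N as [|N IH].
    + rewrite !sum_O. simpl. field.
    + rewrite !sum_Sn, <- IH.
      change (@plus R_NormedModule) with Rplus. change (@plus R_AbelianMonoid) with Rplus.
      set (s := sum_n _ N).
      replace (S N + 2 - 1)%nat with (S (S N)) by lia.
      replace (S N + 2)%nat with (S (S (S N))) by lia.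
      rewrite !S_INR, <- !tech_pow_Rmult. pose proof (pos_INR N). field. lra.
  - replace (Finite (1 - 2 * ln 2)) with (Finite (1 - 2 * ln 2 + 0)) by (f_equal; ring).
    apply is_lim_seq_plus'.
    + apply is_lim_seq_minus'; [apply is_lim_seq_const|].
      apply is_lim_seq_mult'; [apply is_lim_seq_const | exact ln_2_alternating].
    + apply is_lim_seq_abs_0.
      apply is_lim_seq_ext with (fun N => / INR (N + 2)).
      { intro N. rewrite Rabs_mult, pow_1_abs, Rmult_1_l, plus_INR. simpl.
        rewrite Rabs_pos_eq; [f_equal; ring|].
        left. apply Rinv_0_lt_compat. pose proof (pos_INR N). lra. }
      apply (is_lim_seq_incr_n (fun n => / INR n)).
      replace (Finite 0) with (Rbar_inv p_infty) by reflexivity.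
      apply is_lim_seq_inv; [apply is_lim_seq_INR | discriminate].
Qed.

Lemma ln_4 : ln 4 = 2 * ln 2.
Proof. replace 4 with (2 * 2) by ring. rewrite ln_mult by lra. ring. Qed.

Lemma lower_growth_1 (M : R) : lower_growth M 1 = 1 + 2 * M * (1 - 2 * ln 2).
Proof. unfold lower_growth. replace (1 + 1) with 2 by ring. ring. Qed.

(** * Continuity on [0,1) and first zeros *)

Lemma continuous_on_01_plus (u v : R -> R) :
  continuous_on_01 u -> continuous_on_01 v -> continuous_on_01 (fun r => u r + v r).
Proof.
  intros Hu Hv r Hr.
  eapply filterlim_comp_2; [exact (Hu r Hr) | exact (Hv r Hr)|].
  apply (@filterlim_plus R_AbsRing R_NormedModule).
Qed.

Lemma continuous_on_01_mult (u v : R -> R) :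
  continuous_on_01 u -> continuous_on_01 v -> continuous_on_01 (fun r => u r * v r).
Proof.
  intros Hu Hv r Hr.
  eapply filterlim_comp_2; [exact (Hu r Hr) | exact (Hv r Hr)|].
  apply (@filterlim_mult R_AbsRing).
Qed.

Lemma continuous_on_01_const (c : R) : continuous_on_01 (fun _ => c).
Proof. intros r Hr. apply filterlim_const. Qed.

Lemma continuous_on_01_id : continuous_on_01 (fun r => r).
Proof.
  intros r Hr P HP. unfold filtermap, within. revert HP. apply filter_imp. auto.
Qed.

Lemma continuous_on_01_eps (u : R -> R) :
  continuous_on_01 u <->
  forall r, 0 <= r < 1 -> forall eps, 0 < eps ->
    exists delta, 0 < delta /\
      forall s, 0 <= s < 1 -> Rabs (s - r) < delta -> Rabs (u s - u r) < eps.
Proof.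
  split.
  - intros Hu r Hr eps Heps.
    destruct (proj1 (filterlim_locally _ _) (Hu r Hr) (mkposreal eps Heps)) as [delta Hd].
    exists delta. split; [apply cond_pos|].
    intros s Hs Hsr. exact (Hd s Hsr Hs).
  - intros Hu r Hr. apply filterlim_locally. intro eps.
    destruct (Hu r Hr eps (cond_pos eps)) as (delta & Hd & H).
    exists (mkposreal delta Hd). intros s Hsr Hs. exact (H s Hs Hsr).
Qed.

(** The intermediate value theorem alone would not control G to the left of the zero. Here x is the
    supremum of the points up to which G stays negative, and continuity at x excludes both signs of
    G x. *)
Lemma first_crossing (G : R -> R) (a b : R) :
  continuous_on_01 G -> 0 <= a -> a < b -> b < 1 -> G a < 0 -> 0 < G b ->
  exists x, a < x < b /\ G x = 0 /\ forall s, a <= s <= x -> G s <= 0.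
Proof.
  intros HG Ha0 Hab Hb1 Ha Hb.
  pose proof (proj1 (continuous_on_01_eps G) HG) as HGe.
  set (E := fun x => a <= x <= b /\ forall s, a <= s <= x -> G s < 0).
  assert (Ea : E a).
  { split; [lra|]. intros s Hs. replace s with a by lra. exact Ha. }
  destruct (completeness E) as [x [Hub Hlub]].
  { exists b. intros y [Hy _]. lra. }
  { exists a. exact Ea. }
  assert (Hax : a <= x) by (apply Hub; exact Ea).
  assert (Hxb : x <= b) by (apply Hlub; intros y [Hy _]; lra).
  assert (Hbelow : forall s, a <= s < x -> G s < 0).
  { intros s Hs. apply NNPP. intro Hn.
    assert (x <= s); [|lra]. apply Hlub. intros y [Hy Hys].
    destruct (Rle_or_lt y s) as [|Hsy]; [assumption|].
    exfalso. apply Hn, Hys. lra. }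
  assert (Hle : G x <= 0).
  { apply Rnot_lt_le. intro Hpos.
    destruct (HGe x ltac:(lra) (G x) Hpos) as (d & Hd & Hc).
    assert (Hne : a < x) by (destruct (Req_dec a x); [subst x; lra | lra]).
    set (s := Rmax a (x - d / 2)).
    assert (Hs : a <= s < x) by (split; [apply Rmax_l | apply Rmax_lub_lt; lra]).
    assert (Hsd : Rabs (s - x) < d).
    { rewrite Rabs_left1 by lra. pose proof (Rmax_r a (x - d / 2)). fold s in H. lra. }
    specialize (Hc s ltac:(lra) Hsd). specialize (Hbelow s Hs).
    apply Rabs_lt_between in Hc. lra. }
  assert (Hge : 0 <= G x).
  { apply Rnot_lt_le. intro Hneg.
    destruct (HGe x ltac:(lra) (- G x) ltac:(lra)) as (d & Hd & Hc).
    assert (Hne : x < b) by (destruct (Req_dec b x); [subst x; lra | lra]).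
    set (y := Rmin b (x + d / 2)).
    assert (Hy : x < y) by (apply Rmin_glb_lt; lra).
    assert (Hyb : y <= b) by apply Rmin_l.
    assert (Hyd : y <= x + d / 2) by apply Rmin_r.
    assert (E y); [|pose proof (Hub y H); lra].
    split; [lra|]. intros s Hs.
    destruct (Rlt_or_le s x) as [Hsx|Hxs]; [apply Hbelow; lra|].
    specialize (Hc s ltac:(lra)). rewrite Rabs_pos_eq in Hc by lra.
    specialize (Hc ltac:(lra)). apply Rabs_lt_between in Hc. lra. }
  assert (Hx0 : G x = 0) by lra.
  exists x. split; [|split; [exact Hx0|]].
  - destruct (Req_dec a x); [subst x; lra|]. destruct (Req_dec b x); [subst x; lra|]. lra.
  - intros s Hs. destruct (Req_dec s x) as [->|]; [lra|]. left. apply Hbelow. lra.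
Qed.

(** * Continuity of the weighted sum *)

Section PhiSum.

Variable phi : nat -> R -> R.
Hypothesis hphi : class_F phi.

Let wt (k : nat) : R := INR (k + 2) * (INR (k + 2) - 1).

Lemma weight_bounds (k : nat) : 1 <= INR (k + 2) * (INR (k + 2) - 1).
Proof.
  rewrite plus_INR. simpl. pose proof (pos_INR k). nra.
Qed.

Lemma weighted_term_bounds (k : nat) (r : R) :
  0 <= r < 1 -> 0 <= phi (k + 2)%nat r / wt k <= phi (k + 2)%nat r.
Proof.
  intro Hr. pose proof (proj1 (proj2 hphi) (k + 2)%nat r Hr) as H0.
  pose proof (weight_bounds k) as Hw. fold (wt k) in Hw.
  split; [apply Rdiv_le_0_compat; lra|].
  apply Rle_div_l; [lra|]. nra.
Qed.

(** [CVU_dom] measures the distance to the total function [Lim_seq]; the uniform bound at the centre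
    of the neighbourhood shows that this value is a genuine finite limit. *)
Lemma class_F_is_lim (r : R) :
  0 <= r < 1 ->
  is_lim_seq (sum_n (fun n => phi n r)) (real (Lim_seq (sum_n (fun n => phi n r)))).
Proof.
  intro Hr. destruct (proj2 (proj2 hphi) r Hr) as [delta Hd].
  apply is_lim_seq_spec. intro eps.
  specialize (Hd eps). revert Hd. apply filter_imp.
  intros n Hn. apply Hn. split; [exact Hr|].
  rewrite Rminus_diag, Rabs_R0. apply cond_pos.
Qed.

Lemma phi_sum_ex_series (r : R) :
  0 <= r < 1 -> ex_series (fun k => phi (k + 2)%nat r / wt k).
Proof.
  intro Hr.
  apply (@ex_series_le R_AbsRing R_CompleteNormedModule _ (fun k => phi (k + 2)%nat r)).
  - intro k. change (Rabs (phi (k + 2)%nat r / wt k) <= phi (k + 2)%nat r).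
    destruct (weighted_term_bounds k r Hr). rewrite Rabs_pos_eq; assumption.
  - apply ex_series_ext with (fun k => phi (2 + k)%nat r).
    { intro k. now rewrite Nat.add_comm. }
    apply (ex_series_incr_n (fun n => phi n r) 2).
    eexists. exact (class_F_is_lim r Hr).
Qed.

Let W (n : nat) (r : R) : R := sum_n (fun k => phi (k + 2)%nat r / wt k) n.

Lemma phi_sum_is_lim (r : R) : 0 <= r < 1 -> is_lim_seq (fun n => W n r) (phi_sum phi r).
Proof.
  intro Hr. exact (Series_correct _ (phi_sum_ex_series r Hr)).
Qed.

Lemma phi_partial_le (n : nat) (r : R) : 0 <= r < 1 -> W n r <= phi_sum phi r.
Proof.
  intro Hr.
  apply (is_lim_seq_incr_compare (fun n => W n r)); [exact (phi_sum_is_lim r Hr)|].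
  intro m. unfold W. rewrite sum_Sn. unfold plus. simpl.
  pose proof (proj1 (weighted_term_bounds (S m) r Hr)). simpl in H. lra.
Qed.

Lemma phi_sum_nonneg (r : R) : 0 <= r < 1 -> 0 <= phi_sum phi r.
Proof.
  intro Hr. eapply Rle_trans; [|exact (phi_partial_le 0 r Hr)].
  unfold W. rewrite sum_O. exact (proj1 (weighted_term_bounds 0 r Hr)).
Qed.

(** This carries locally uniform convergence over to the weighted series: all weights are at least
    1, so weighted tails are smaller. [W n] ends with phi_(n+2), hence the shift by 2. *)
Lemma phi_sum_tail (n : nat) (r : R) :
  0 <= r < 1 ->
  phi_sum phi r - W n r <=
    real (Lim_seq (sum_n (fun n => phi n r))) - sum_n (fun n => phi n r) (n + 2).
Proof.
  intro Hr.
  pose proof (is_lim_seq_minus' _ _ _ _ (phi_sum_is_lim r Hr)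
    (proj1 (is_lim_seq_incr_n _ 2 _) (class_F_is_lim r Hr))) as Hlim.
  assert (phi_sum phi r - real (Lim_seq (sum_n (fun n => phi n r)))
          <= W n r - sum_n (fun n => phi n r) (n + 2)); [|lra].
  apply (is_lim_seq_decr_compare _ _ Hlim).
  intro m. change (S m + 2)%nat with (S (m + 2)). unfold W. rewrite !sum_Sn.
  unfold plus. simpl.
  pose proof (proj2 (weighted_term_bounds (S m) r Hr)). simpl in H. lra.
Qed.

Lemma continuous_on_01_phi_partial (n : nat) : continuous_on_01 (W n).
Proof.
  assert (Hterm : forall k, continuous_on_01 (fun r => phi (k + 2)%nat r / wt k)).
  { intro k. apply continuous_on_01_mult; [apply (proj1 hphi) | apply continuous_on_01_const]. }
  induction n as [|n IH]; intros r Hr.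
  - unfold W. rewrite sum_O.
    apply (filterlim_ext (fun s => phi (0 + 2)%nat s / wt 0)); [|exact (Hterm 0%nat r Hr)].
    intro s. symmetry. apply sum_O.
  - unfold W. rewrite sum_Sn.
    apply (filterlim_ext (fun s => W n s + phi (S n + 2)%nat s / wt (S n))).
    { intro s. rewrite sum_Sn. reflexivity. }
    exact (continuous_on_01_plus _ _ IH (Hterm (S n)) r Hr).
Qed.

Lemma continuous_on_01_phi_sum : continuous_on_01 (phi_sum phi).
Proof.
  apply continuous_on_01_eps. intros r Hr eps Heps.
  destruct (proj2 (proj2 hphi) r Hr) as [d1 Hd1].
  assert (He3 : 0 < eps / 3) by lra.
  destruct (Hd1 (mkposreal _ He3)) as [N HN].
  specialize (HN (N + 2)%nat ltac:(lia)). cbn [pos] in HN.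
  assert (Htail : forall s, 0 <= s < 1 -> Rabs (s - r) < d1 ->
            W N s <= phi_sum phi s < W N s + eps / 3).
  { intros s Hs Hsr. specialize (HN s (conj Hs Hsr)). apply Rabs_lt_between in HN.
    change (- (eps / 3) < sum_n (fun n => phi n s) (N + 2)
                          - real (Lim_seq (sum_n (fun n => phi n s))) < eps / 3) in HN.
    pose proof (phi_sum_tail N s Hs). pose proof (phi_partial_le N s Hs). lra. }
  destruct (proj1 (continuous_on_01_eps _) (continuous_on_01_phi_partial N) r Hr _ He3)
    as (d2 & Hd2 & Hc).
  exists (Rmin d1 d2). split; [apply Rmin_glb_lt; [apply cond_pos | exact Hd2]|].
  intros s Hs Hsr.
  assert (H1 : Rabs (s - r) < d1) by (eapply Rlt_le_trans; [exact Hsr | apply Rmin_l]).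
  assert (H2 : Rabs (s - r) < d2) by (eapply Rlt_le_trans; [exact Hsr | apply Rmin_r]).
  pose proof (Htail s Hs H1).
  assert (Hr0 : Rabs (r - r) < d1) by (rewrite Rminus_diag, Rabs_R0; apply cond_pos).
  pose proof (Htail r Hr Hr0).
  specialize (Hc s Hs H2). apply Rabs_lt_between in Hc. apply Rabs_lt_between. lra.
Qed.

End PhiSum.

(** * The class P0H(M) *)

Lemma is_pser_unique (c : nat -> C) (H : C -> C) (z : C) :
  is_pser c H -> Cmod z < 1 -> psum c z = H z.
Proof.
  intros Hc Hz. unfold psum.
  rewrite (surjective_pairing (H z)). f_equal; apply is_series_unique.
  - exact (is_series_Re _ _ (Hc z Hz)).
  - exact (is_series_Im _ _ (Hc z Hz)).
Qed.

Lemma is_pser_dcoef (c : nat -> C) (H : C -> C) :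
  is_pser c H -> is_pser (dcoef c) (psum (dcoef c)).
Proof.
  intro Hc. exact (is_pser_psum _ (abs_conv_dcoef c (is_pser_abs_conv c H Hc))).
Qed.

Lemma is_pser_lin (c d : nat -> C) (H G : C -> C) (e : C) :
  is_pser c H -> is_pser d G ->
  is_pser (fun k => (c k + e * d k)%C) (fun z => (H z + e * G z)%C).
Proof.
  intros Hc Hd z Hz.
  eapply is_series_ext;
    [|apply is_series_plus_C; [exact (Hc z Hz) | exact (is_series_scal_C e _ _ (Hd z Hz))]].
  intro k. eq_in_C. simpl. ring.
Qed.

Lemma is_pser_ext (c d : nat -> C) (H G : C -> C) :
  (forall k, c k = d k) -> (forall z, Cmod z < 1 -> H z = G z) -> is_pser c H -> is_pser d G.
Proof.
  intros Hcd HHG Hc z Hz. rewrite <- (HHG z Hz).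
  eapply is_series_ext; [|exact (Hc z Hz)].
  intro k. cbv beta. now rewrite Hcd.
Qed.

Lemma pser_C_derive (c : nat -> C) (H : C -> C) (z : C) :
  is_pser c H -> Cmod z < 1 -> C_derive H z = psum (dcoef c) z.
Proof.
  intros Hc Hz. apply is_C_derive_unique.
  exact (pser_is_derive c H _ z Hc (is_pser_dcoef c H Hc) Hz).
Qed.

Lemma locally_unit_disk (z : C) :
  Cmod z < 1 ->
  @locally (AbsRing_UniformSpace C_AbsRing) z (fun y => Cmod y < 1).
Proof.
  intro Hz. assert (He : 0 < 1 - Cmod z) by lra.
  assert (Hy : forall y : C, Cmod (y - z) < 1 - Cmod z -> Cmod y < 1).
  { intros y Hy. pose proof (Cmod_triangle (y - z) z) as Ht.
    replace (y - z + z)%C with y in Ht by ring. lra. }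
  exists (mkposreal _ He). exact Hy.
Qed.

Lemma pser_C_derive_2 (c : nat -> C) (H : C -> C) (z : C) :
  is_pser c H -> Cmod z < 1 -> C_derive (C_derive H) z = psum (dcoef (dcoef c)) z.
Proof.
  intros Hc Hz. apply is_C_derive_unique.
  pose proof (is_pser_dcoef c H Hc) as H1.
  (* [C_derive H] agrees with the derived series only inside the disk, so the outer derivative is
     taken through a neighbourhood. *)
  apply (is_derive_ext_loc (psum (dcoef c))).
  - generalize (locally_unit_disk z Hz). apply filter_imp.
    intros y Hy. symmetry. exact (pser_C_derive c H y Hc Hy).
  - exact (pser_is_derive _ _ _ z H1 (is_pser_dcoef _ _ H1) Hz).
Qed.

(** [has_coefficients] constrains indices from 2 on; entries 0 and 1 are set to the normalisation,
    with x = 1 for h and x = 0 for g. *)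
Definition full_coef (x : C) (a : nat -> C) (k : nat) : C :=
  match k with O => 0%C | S O => x | _ => a k end.

Lemma is_pser_full_coef (x : C) (a : nat -> C) (H : C -> C) :
  (forall z, Cmod z < 1 ->
     @is_series C_AbsRing C_NormedModule
       (fun k => (a (k + 2)%nat * z ^ (k + 2))%C) (H z - x * z)%C) ->
  is_pser (full_coef x a) H.
Proof.
  intros Ha z Hz.
  replace (H z) with (full_coef x a 0 * z ^ 0 + (full_coef x a 1 * z ^ 1 + (H z - x * z)))%C
    by (simpl; ring).
  apply (is_series_decr_1_C (fun k => (full_coef x a k * z ^ k)%C)).
  apply (is_series_decr_1_C (fun k => (full_coef x a (S k) * z ^ S k)%C)).
  eapply is_series_ext; [|exact (Ha z Hz)].
  intro k. cbv beta. replace (k + 2)%nat with (S (S k)) by lia. reflexivity.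
Qed.

Section ClassP.

Variables (M : R) (h g : C -> C) (a b : nat -> C).
Hypothesis hM : 0 < M.
Hypothesis hP : class_P0H M h g.
Hypothesis hab : has_coefficients h g a b.

Lemma class_pser_h : is_pser (full_coef 1 a) h.
Proof.
  apply is_pser_full_coef. intros z Hz.
  rewrite Cmult_1_l. exact (proj1 (hab z Hz)).
Qed.

Lemma class_pser_g : is_pser (full_coef 0 b) g.
Proof.
  apply is_pser_full_coef. intros z Hz.
  replace (g z - 0 * z)%C with (g z) by ring. exact (proj2 (hab z Hz)).
Qed.

(* Rotating g by a unimodular e turns the defining inequality into the
   half-plane condition Re (z F'') > -M for F = h + e g. *)
Lemma class_half_plane (e z : C) :
  Cmod e = 1 -> Cmod z < 1 ->
  - M < Re (z * psum (dcoef (dcoef (fun k => (full_coef 1 a k + e * full_coef 0 b k)%C))) z)%C.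
Proof.
  intros He Hz.
  pose proof (proj2 hP z Hz) as Hlt.
  rewrite (pser_C_derive_2 _ _ z class_pser_h Hz), (pser_C_derive_2 _ _ z class_pser_g Hz) in Hlt.
  assert (E : psum (dcoef (dcoef (fun k => (full_coef 1 a k + e * full_coef 0 b k)%C))) z
    = (psum (dcoef (dcoef (full_coef 1 a))) z + e * psum (dcoef (dcoef (full_coef 0 b))) z)%C).
  { apply (is_pser_unique _ (fun z => (psum (dcoef (dcoef (full_coef 1 a))) z
                                 + e * psum (dcoef (dcoef (full_coef 0 b))) z)%C)); [|exact Hz].
    apply (is_pser_ext
      (fun k => (dcoef (dcoef (full_coef 1 a)) k + e * dcoef (dcoef (full_coef 0 b)) k)%C) _
      (fun z => (psum (dcoef (dcoef (full_coef 1 a))) z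
                 + e * psum (dcoef (dcoef (full_coef 0 b))) z)%C)).
    - intro k. unfold dcoef. ring.
    - reflexivity.
    - apply is_pser_lin; [exact (is_pser_dcoef _ _ (is_pser_dcoef _ _ class_pser_h))|].
      exact (is_pser_dcoef _ _ (is_pser_dcoef _ _ class_pser_g)). }
  rewrite E.
  set (x := psum (dcoef (dcoef (full_coef 1 a))) z) in *.
  set (y := psum (dcoef (dcoef (full_coef 0 b))) z) in *.
  replace (z * (x + e * y))%C with (z * x + e * (z * y))%C by ring.
  rewrite re_plus.
  pose proof (re_le_Cmod (e * (z * y))%C) as Hre.
  rewrite Cmod_mult, He, Rmult_1_l in Hre.
  apply Rabs_le_between in Hre. lra.
Qed.

(** The rotation e is chosen for this index so that a_n and e b_n have the same argument, which
    makes |a_n + e b_n| equal to |a_n| + |b_n|. *)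
Lemma class_coef_bound (k : nat) :
  Cmod (a (k + 2)%nat) + Cmod (b (k + 2)%nat) <= 2 * M / (INR (k + 2) * (INR (k + 2) - 1)).
Proof.
  destruct (unit_rotation (a (k + 2)%nat)) as (ea & Hea & Ha).
  destruct (unit_rotation (b (k + 2)%nat)) as (eb & Heb & Hb).
  set (e := (eb * Cconj ea)%C).
  assert (He : Cmod e = 1) by (unfold e; rewrite Cmod_mult, Cmod_conj, Hea, Heb; ring).
  pose proof (half_plane_coef_bound M _ _ (is_pser_lin _ _ _ _ e class_pser_h class_pser_g)
    (fun z => class_half_plane e z He) k) as Hk.
  cbv beta in Hk.
  assert (Eh : full_coef 1 a (k + 2) = a (k + 2)%nat)
    by (replace (k + 2)%nat with (S (S k)) by lia; reflexivity).
  assert (Eg : full_coef 0 b (k + 2) = b (k + 2)%nat)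
    by (replace (k + 2)%nat with (S (S k)) by lia; reflexivity).
  rewrite Eh, Eg in Hk.
  refine (Rle_trans _ _ _ _ Hk). right.
  assert (Eu : (ea * Cconj ea)%C = 1%C) by (rewrite <- Cmod2_conj, Hea, pow1; reflexivity).
  assert (E : ((a (k + 2)%nat + e * b (k + 2)%nat) * ea)%C
     = RtoC (Cmod (a (k + 2)%nat) + Cmod (b (k + 2)%nat))).
  { rewrite RtoC_plus, <- Ha, <- Hb. unfold e.
    replace ((a (k + 2)%nat + eb * Cconj ea * b (k + 2)%nat) * ea)%C
      with (a (k + 2)%nat * ea + b (k + 2)%nat * eb * (ea * Cconj ea))%C by ring.
    rewrite Eu. ring. }
  apply (f_equal Cmod) in E. rewrite Cmod_mult, Hea, Cmod_R, Rmult_1_r in E.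
  rewrite E, Rabs_pos_eq; [reflexivity|].
  apply Rplus_le_le_0_compat; apply Cmod_ge_0.
Qed.

(** For z nonzero e = (z/|z|)^2, so that conj z e = z and Re (conj z e g(z)) = Re (z g(z)) = Re
    (conj z conj g(z)). At this one point h + e g and h + conj g thus have the same radial
    component. *)
Lemma class_growth (z : C) :
  Cmod z < 1 ->
  Cmod z * lower_growth M (Cmod z) <= Re (Cconj z * harmonic_map h g z)%C.
Proof.
  intro Hz.
  destruct (unit_rotation z) as (eta & Heta & Hzeta).
  set (e := (Cconj eta * Cconj eta)%C).
  assert (He : Cmod e = 1) by (unfold e; rewrite Cmod_mult, Cmod_conj, Heta; ring).
  pose proof (half_plane_growth M _ _ (is_pser_lin _ _ _ _ e class_pser_h class_pser_g)
    ltac:(simpl; ring) ltac:(simpl; ring) (fun z => class_half_plane e z He) z Hz) as Hg.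
  cbv beta in Hg.
  refine (Rle_trans _ _ _ Hg _). right.
  unfold harmonic_map.
  replace (Cconj z * (h z + e * g z))%C with (Cconj z * h z + Cconj z * e * g z)%C by ring.
  replace (Cconj z * (h z + Cconj (g z)))%C with (Cconj z * h z + Cconj (z * g z))%C
    by (rewrite Cmult_conj; ring).
  rewrite !re_plus, re_conj. f_equal. f_equal. f_equal.
  assert (Eu : (eta * Cconj eta)%C = 1%C) by (rewrite <- Cmod2_conj, Heta, pow1; reflexivity).
  assert (Ez : z = (Cmod z * Cconj eta)%C)
    by (rewrite <- Hzeta; replace (z * eta * Cconj eta)%C with (z * (eta * Cconj eta))%C by ring;
        rewrite Eu; ring).
  assert (Ec : Cconj z = (Cmod z * eta)%C).
  { rewrite Ez at 1. rewrite Cmult_conj, Cconj_conj. f_equal.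
    unfold Cconj, RtoC. simpl. f_equal. ring. }
  rewrite Ec. unfold e.
  transitivity (Cmod z * Cconj eta * (eta * Cconj eta))%C; [ring|].
  rewrite Eu, <- Ez. ring.
Qed.

(** The winding argument runs on a circle of radius r < 1, so a strict bound at 1 has to be moved
    inside. *)
Lemma lower_growth_gt_near_1 (x : R) :
  x < lower_growth M 1 -> exists r, 0 < r < 1 /\ x < lower_growth M r.
Proof.
  intro Hx.
  assert (Hc : continuity_pt (lower_growth M) 1).
  { apply derivable_continuous_pt, ex_derive_Reals_0. unfold lower_growth.
    auto_derive. lra. }
  assert (He : 0 < lower_growth M 1 - x) by lra.
  destruct (proj1 (continuity_pt_locally _ _) Hc (mkposreal _ He)) as [d Hd].
  set (r := 1 - Rmin (d / 2) (1 / 2)).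
  pose proof (cond_pos d) as Hd0.
  pose proof (Rmin_l (d / 2) (1 / 2)) as Hm1. pose proof (Rmin_r (d / 2) (1 / 2)) as Hm2.
  assert (Hm0 : 0 < Rmin (d / 2) (1 / 2)) by (apply Rmin_glb_lt; lra).
  exists r. split; [unfold r; lra|].
  assert (Hr : Rabs (r - 1) < d) by (rewrite Rabs_left1; unfold r; lra).
  specialize (Hd r Hr). cbn [pos] in Hd. apply Rabs_lt_between in Hd. lra.
Qed.

Lemma class_covering (w : C) :
  Cmod w < lower_growth M 1 -> image_disk (harmonic_map h g) w.
Proof.
  intro Hw.
  destruct (lower_growth_gt_near_1 (Cmod w) Hw) as (r & Hr & Hlr).
  apply (harmonic_covering _ _ h g w r class_pser_h class_pser_g Hr).
  intros z Hz.
  pose proof (class_growth z ltac:(lra)) as Hg.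
  rewrite Hz in Hg. unfold harmonic_map in Hg.
  replace (Cconj z * (h z + Cconj (g z) - w))%C
    with (Cconj z * (h z + Cconj (g z)) - Cconj z * w)%C by ring.
  unfold Cminus at 1. rewrite re_plus, re_opp.
  pose proof (re_le_Cmod (Cconj z * w)%C) as Hre.
  rewrite Cmod_mult, Cmod_conj, Hz in Hre. apply Rabs_le_between in Hre.
  assert (r * Cmod w < r * lower_growth M r) by (apply Rmult_lt_compat_l; lra).
  lra.
Qed.

Lemma class_boundary_distance_ge :
  Rbar_le (lower_growth M 1) (boundary_distance (harmonic_map h g)).
Proof.
  unfold boundary_distance, distance.
  apply (proj2 (Glb_Rbar_correct _)).
  intros d (w & Hw & ->).
  assert (H0 : harmonic_map h g 0%C = 0%C).
  { destruct hP as [(_ & _ & Hh0 & _ & Hg0 & _) _]. unfold harmonic_map.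
    rewrite Hh0, Hg0. apply injective_projections; simpl; ring. }
  assert (Ew : forall x : C, (x - 0)%C = x) by (intro x; ring).
  rewrite H0, Ew.
  simpl. apply Rnot_lt_le. intro Hlt.
  (* The ball of this radius about w lies in the covered disk, whereas a boundary point has omitted
     values in every ball. *)
  destruct (Hw (lower_growth M 1 - Cmod w) ltac:(lra)) as [_ (u & Hu & Huw)].
  apply Hu, class_covering.
  pose proof (Cmod_triangle (u - w) w) as Ht.
  assert (Eu : forall x y : C, (x - y + y)%C = x) by (intros x y; ring).
  rewrite Eu in Ht. lra.
Qed.

Lemma class_bohr_sum_le (phi : nat -> R -> R) (r : R) :
  class_F phi -> 0 <= r < 1 ->
  Rbar_le (bohr_sum a b phi r) (r * phi 0%nat r + 2 * M * phi_sum phi r).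
Proof.
  intros Hphi Hr.
  set (u := sum_n (fun k => (Cmod (a (k + 2)%nat) + Cmod (b (k + 2)%nat)) * phi (k + 2)%nat r)).
  assert (Hu : forall n, u n <= 2 * M * phi_sum phi r).
  { intro n.
    eapply Rle_trans; [|apply Rmult_le_compat_l; [lra | exact (phi_partial_le phi Hphi n r Hr)]].
    rewrite <- (sum_n_mult_l (K := R_Ring)).
    apply (sum_n_m_le _ _ 0 n). intro k.
    change (mult (2 * M) (phi (k + 2)%nat r / (INR (k + 2) * (INR (k + 2) - 1))))
      with (2 * M * (phi (k + 2)%nat r / (INR (k + 2) * (INR (k + 2) - 1)))).
    pose proof (class_coef_bound k) as Hk.
    pose proof (proj1 (proj2 Hphi) (k + 2)%nat r Hr) as Hp.
    apply (Rmult_le_compat_r _ _ _ Hp) in Hk.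
    refine (Rle_trans _ _ _ Hk _). right. unfold Rdiv. ring. }
  assert (HL : Rbar_le (Lim_seq u) (2 * M * phi_sum phi r)).
  { rewrite <- (Lim_seq_const (2 * M * phi_sum phi r)). apply Lim_seq_le_loc.
    exists 0%nat. intros n _. apply Hu. }
  unfold bohr_sum. fold u.
  destruct (Lim_seq u) as [l| |]; simpl in *; [lra | contradiction | exact I].
Qed.

End ClassP.

(** * The extremal mapping *)

Lemma is_series_C_unique (u : nat -> C) (l1 l2 : C) :
  @is_series C_AbsRing C_NormedModule u l1 -> @is_series C_AbsRing C_NormedModule u l2 -> l1 = l2.
Proof.
  intros H1 H2. apply injective_projections.
  - exact (eq_trans (eq_sym (is_series_unique _ _ (is_series_Re _ _ H1)))
             (is_series_unique _ _ (is_series_Re _ _ H2))).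
  - exact (eq_trans (eq_sym (is_series_unique _ _ (is_series_Im _ _ H1)))
             (is_series_unique _ _ (is_series_Im _ _ H2))).
Qed.

Lemma is_series_zero_C : @is_series C_AbsRing C_NormedModule (fun _ => RtoC 0) (RtoC 0).
Proof.
  apply filterlim_ext with (fun _ => RtoC 0); [|apply filterlim_const].
  intro n. induction n as [|n IH]; [now rewrite sum_O|].
  rewrite sum_Sn, <- IH. symmetry. exact (Cplus_0_r 0).
Qed.

Lemma abs_conv_bounded (c : nat -> C) (B : R) : (forall k, Cmod (c k) <= B) -> abs_conv c.
Proof.
  intros Hc r Hr.
  apply (@ex_series_le R_AbsRing R_CompleteNormedModule _ (fun k => B * r ^ k)).
  - intro k. change (Rabs (Cmod (c k) * r ^ k) <= B * r ^ k).
    assert (Hk : 0 <= r ^ k) by (apply pow_le; lra).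
    rewrite Rabs_pos_eq by (apply Rmult_le_pos; [apply Cmod_ge_0 | exact Hk]).
    apply Rmult_le_compat_r; [exact Hk | apply Hc].
  - apply (@ex_series_scal R_AbsRing R_NormedModule B (fun k => r ^ k)).
    apply ex_series_geom. rewrite Rabs_pos_eq; lra.
Qed.

(** Dropping the first term and multiplying by z give the same series, so s - x = z s. *)
Lemma psum_geometric (x z : C) : Cmod z < 1 -> psum (fun _ => x) z = (x / (1 - z))%C.
Proof.
  intro Hz.
  assert (Hs : is_pser (fun _ => x) (psum (fun _ => x))).
  { apply is_pser_psum, (abs_conv_bounded _ (Cmod x)). intro k. apply Rle_refl. }
  specialize (Hs z Hz). set (s := psum (fun _ => x) z) in *.
  pose proof (is_series_incr_1_C _ _ Hs) as H1. cbv beta in H1.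
  assert (H2 : @is_series C_AbsRing C_NormedModule (fun k => (x * z ^ S k)%C) (z * s)%C).
  { eapply is_series_ext; [|exact (is_series_scal_C z _ _ Hs)].
    intro k. eq_in_C. simpl. ring. }
  pose proof (is_series_C_unique _ _ _ H1 H2) as E. simpl in E.
  assert (Hx : x = (s * (1 - z))%C).
  { replace (s * (1 - z))%C with (s - z * s)%C by ring. rewrite <- E. ring. }
  rewrite Hx. field. exact (one_minus_neq_0 z Hz).
Qed.

(** Equality in the coefficient bound, with z F'' = 2M z/(1-z). The divisions by zero at n = 0 and n
    = 1 are overwritten by [full_coef]. *)
Definition extremal_coef (M : R) (n : nat) : C := RtoC (2 * M / (INR n * (INR n - 1))).

Definition extremal (M : R) : C -> C := psum (full_coef 1 (extremal_coef M)).

Lemma Re_inv_one_minus_gt (z : C) : Cmod z < 1 -> 1 / 2 < Re (/ (1 - z))%C.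
Proof.
  intro Hz. pose proof (Cmod_ge_0 z) as Hz0.
  assert (Hxy : Re z ^ 2 + Im z ^ 2 < 1) by (rewrite <- Cmod2_alt; nra).
  rewrite Re_inv_one_minus. pose proof (re_le_Cmod z) as Hre. apply Rabs_le_between in Hre.
  assert (0 < (1 - Re z) ^ 2) by (apply pow_lt; lra).
  pose proof (pow2_ge_0 (Im z)).
  apply (Rlt_div_r (1 / 2)); lra.
Qed.

Lemma is_C_derive_const (x z : C) : @is_derive C_AbsRing C_NormedModule (fun _ => x) z (RtoC 0).
Proof. exact (@is_derive_const C_AbsRing C_NormedModule x z). Qed.

Section Extremal.

Variable M : R.
Hypothesis hM : 0 < M.

Let c := full_coef 1 (extremal_coef M).

Lemma extremal_pser : is_pser c (extremal M).
Proof.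
  apply is_pser_psum, (abs_conv_bounded _ (2 * M + 1)).
  intros [|[|k]].
  - simpl. rewrite Cmod_0. lra.
  - simpl. rewrite Cmod_1. lra.
  - change (Cmod (extremal_coef M (S (S k))) <= 2 * M + 1).
    replace (S (S k)) with (k + 2)%nat by lia.
    pose proof (weight_bounds k) as Hw. unfold extremal_coef.
    rewrite Cmod_R, Rabs_pos_eq by (apply Rdiv_le_0_compat; lra).
    apply Rle_div_l; [lra|]. nra.
Qed.

Lemma extremal_second (z : C) :
  Cmod z < 1 -> psum (dcoef (dcoef c)) z = (2 * M / (1 - z))%C.
Proof.
  intro Hz. rewrite <- (psum_geometric (2 * M)%C z Hz).
  apply is_pser_unique; [|exact Hz].
  apply (is_pser_ext (fun _ => (2 * M)%C) _ (psum (fun _ => (2 * M)%C))).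
  - intro k. unfold dcoef. change (c (S (S k))) with (extremal_coef M (S (S k))).
    unfold extremal_coef. rewrite <- !RtoC_mult. f_equal.
    rewrite (S_INR (S k)). pose proof (lt_0_INR (S k) ltac:(lia)).
    field. lra.
  - reflexivity.
  - apply is_pser_psum, (abs_conv_bounded _ (Cmod (2 * M)%C)). intro k. apply Rle_refl.
Qed.

(** Written as 2M (1/(1-z) - 1), this rests on 1/(1-z) mapping the disk into Re > 1/2. *)
Lemma extremal_half_plane (z : C) :
  Cmod z < 1 -> - M < Re (z * psum (dcoef (dcoef c)) z)%C.
Proof.
  intro Hz. rewrite (extremal_second z Hz).
  replace (z * (2 * M / (1 - z)))%C with (RtoC (2 * M) * (/ (1 - z) - 1))%C.
  2:{ rewrite RtoC_mult. field. exact (one_minus_neq_0 z Hz). }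
  rewrite re_scal_l. unfold Cminus at 1. rewrite re_plus, re_opp, re_RtoC.
  pose proof (Re_inv_one_minus_gt z Hz). nra.
Qed.

Lemma extremal_at_0 : extremal M 0%C = 0%C.
Proof. exact (pser_at_0 c _ extremal_pser). Qed.

Lemma extremal_class : class_P0H M (extremal M) (fun _ => 0%C).
Proof.
  assert (H1 := is_pser_dcoef _ _ extremal_pser).
  assert (H0 : Cmod 0 < 1) by (rewrite Cmod_0; lra).
  assert (Hd0 : forall z, C_derive (fun _ : C => RtoC 0) z = 0%C)
    by (intro z; apply is_C_derive_unique, is_C_derive_const).
  split.
  - refine (conj _ (conj _ (conj extremal_at_0 (conj _ (conj eq_refl (Hd0 _)))))).
    + intros z Hz. eexists. exact (pser_is_derive _ _ _ z extremal_pser H1 Hz).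
    + intros z _. eexists. apply is_C_derive_const.
    + rewrite (pser_C_derive c _ _ extremal_pser H0), (pser_at_0 _ _ H1).
      unfold dcoef. simpl. ring.
  - intros z Hz.
    rewrite (pser_C_derive_2 c _ z extremal_pser Hz).
    replace (C_derive (C_derive (fun _ : C => RtoC 0)) z) with (RtoC 0).
    + rewrite Cmult_0_r, Cmod_0, Rplus_0_r. exact (extremal_half_plane z Hz).
    + symmetry. apply is_C_derive_unique.
      apply (is_derive_ext (fun _ => RtoC 0)); [intro t; symmetry; apply Hd0|].
      apply is_C_derive_const.
Qed.

Lemma extremal_has_coefficients :
  has_coefficients (extremal M) (fun _ => 0%C) (extremal_coef M) (fun _ => 0%C).
Proof.
  intros z Hz. split.
  - pose proof (is_series_incr_1_C _ _ (is_series_incr_1_C _ _ (extremal_pser z Hz))) as Hs.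
    match type of Hs with is_series _ ?l => replace (extremal M z - z)%C with l end.
    2:{ simpl. ring. }
    eapply is_series_ext; [|exact Hs].
    intro k. cbv beta. replace (k + 2)%nat with (S (S k)) by lia. reflexivity.
  - eapply is_series_ext; [|exact is_series_zero_C].
    intro k. symmetry. apply Cmult_0_l.
Qed.

Lemma extremal_bohr_sum (phi : nat -> R -> R) (r : R) :
  class_F phi -> 0 <= r < 1 ->
  bohr_sum (extremal_coef M) (fun _ => 0%C) phi r = r * phi 0%nat r + 2 * M * phi_sum phi r.
Proof.
  intros Hphi Hr. unfold bohr_sum.
  rewrite (is_lim_seq_unique _ (2 * M * phi_sum phi r)); [reflexivity|].
  apply is_lim_seq_ext with
    (fun n => 2 * M * sum_n (fun k => phi (k + 2)%nat r / (INR (k + 2) * (INR (k + 2) - 1))) n).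
  - intro n.
    rewrite <- (sum_n_mult_l (K := R_Ring)). apply sum_n_ext. intro k.
    rewrite Cmod_0, Rplus_0_r. unfold extremal_coef. pose proof (weight_bounds k).
    rewrite Cmod_R, Rabs_pos_eq by (apply Rdiv_le_0_compat; lra).
    unfold mult; simpl; unfold Rdiv. ring.
  - apply is_lim_seq_mult'; [apply is_lim_seq_const|].
    exact (Series_correct _ (phi_sum_ex_series phi Hphi r Hr)).
Qed.

(** On the negative axis Harnack's bound is attained, since F''(-s) = 2M/(1+s), so both integrations
    are exact. Each is a mean value argument for a function with zero derivative, with the left end
    treated apart. *)
Lemma extremal_negative_axis (r : R) :
  0 <= r < 1 -> Re (extremal M (RtoC (- r))) = - lower_growth M r.
Proof.
  intro Hr.
  assert (H1 := is_pser_dcoef _ _ extremal_pser).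
  assert (H2 := is_pser_dcoef _ _ H1).
  assert (Harg : forall u, (0 + RtoC u * RtoC (-1))%C = RtoC (- u))
    by (intro u; apply injective_projections; simpl; ring).
  assert (Hin : forall u, 0 <= u < 1 -> Cmod (0 + RtoC u * RtoC (-1))%C < 1).
  { intros u Hu. rewrite Harg, Cmod_R, Rabs_Ropp, Rabs_pos_eq; lra. }
  assert (D1 : forall u, 0 <= u < 1 ->
            Re (psum (dcoef c) (RtoC (- u))) = 1 - 2 * M * ln (1 + u)).
  { intros u Hu.
    destruct (Req_dec u 0) as [->|Hu0].
    { rewrite Ropp_0, (pser_at_0 _ _ H1), Rplus_0_r, ln_1. unfold dcoef. simpl. ring. }
    destruct (MVT_cor2
      (fun s => Re (1 * psum (dcoef c) (0 + RtoC s * RtoC (-1)))%C + 2 * M * ln (1 + s))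
      (fun s => Re (1 * (RtoC (-1) * psum (dcoef (dcoef c)) (0 + RtoC s * RtoC (-1))))%C
                + 2 * M * / (1 + s)) 0 u ltac:(lra)) as (s & Hs & Hsu).
    { intros s Hs. apply derivable_pt_lim_plus.
      - apply (pser_derive_line _ _ _ 1%C 0%C (RtoC (-1)) s H1 H2). apply Hin. lra.
      - apply is_derive_Reals. auto_derive; [lra|]. field. lra. }
    rewrite !Harg, !Cmult_1_l, Ropp_0, (pser_at_0 _ _ H1), Rplus_0_r, ln_1 in Hs.
    rewrite extremal_second in Hs by (rewrite <- Harg; apply Hin; lra).
    rewrite re_scal_l in Hs.
    replace (2 * M / (1 - RtoC (- s)))%C with (RtoC (2 * M / (1 + s))) in Hs.
    2:{ rewrite RtoC_div, RtoC_mult, RtoC_plus, RtoC_opp by lra. f_equal. ring. }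
    rewrite re_RtoC in Hs. unfold dcoef at 2 in Hs.
    replace (Re (INR 1 * c 1%nat)%C) with 1 in Hs by (simpl; ring).
    unfold Rdiv in Hs. lra. }
  destruct (Req_dec r 0) as [->|Hr0].
  { rewrite Ropp_0, extremal_at_0. unfold lower_growth. rewrite Rplus_0_r, ln_1, re_RtoC. ring. }
  destruct (MVT_cor2
    (fun s => Re (1 * extremal M (0 + RtoC s * RtoC (-1)))%C + lower_growth M s)
    (fun s => Re (1 * (RtoC (-1) * psum (dcoef c) (0 + RtoC s * RtoC (-1))))%C
              + (1 - 2 * M * ln (1 + s))) 0 r ltac:(lra)) as (s & Hs & Hsr).
  { intros s Hs. apply derivable_pt_lim_plus.
    - apply (pser_derive_line c _ _ 1%C 0%C (RtoC (-1)) s extremal_pser H1). apply Hin. lra.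
    - apply is_derive_Reals. unfold lower_growth. auto_derive; [lra|]. field. lra. }
  rewrite !Harg, !Cmult_1_l, Ropp_0, extremal_at_0, re_scal_l, D1, re_RtoC in Hs by lra.
  unfold lower_growth at 2 in Hs. rewrite Rplus_0_r, ln_1 in Hs. lra.
Qed.

Lemma extremal_real_axis (x : R) : Im (extremal M (RtoC x)) = 0.
Proof.
  change (Series (fun k => Im (c k * RtoC x ^ k)%C) = 0).
  rewrite (Series_ext _ (fun _ => 0)).
  - apply is_series_unique. apply (filterlim_ext (fun _ => 0)); [|apply filterlim_const].
    intro n. rewrite sum_n_const. symmetry. apply Rmult_0_r.
  - intro k.
    assert (E : exists y : R, c k = RtoC y) by (destruct k as [|[|k]]; eexists; reflexivity).
    destruct E as [y Ey]. rewrite Ey, <- RtoC_pow, <- RtoC_mult. reflexivity.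
Qed.

Hypothesis hM4 : M <= 1 / ln 4.

(** As ln 4 = 2 ln 2, the condition on M says exactly that 1 - 2M ln(1+u), which bounds Re F' from
    below and is the derivative of [lower_growth M], stays nonnegative up to u = 1. *)
Lemma two_M_ln_le_1 (u : R) : 0 <= u <= 1 -> 2 * M * ln (1 + u) <= 1.
Proof.
  intro Hu. rewrite ln_4 in hM4. pose proof ln_lt_2.
  apply Rle_div_r in hM4; [|lra].
  assert (ln (1 + u) <= ln 2) by (apply Rcomplements.ln_le; lra).
  assert (2 * M * ln (1 + u) <= 2 * M * ln 2) by (apply Rmult_le_compat_l; lra).
  lra.
Qed.

Lemma lower_growth_increasing (x y : R) :
  0 <= x <= y -> y <= 1 -> lower_growth M x <= lower_growth M y.
Proof.
  intros Hx Hy. destruct (Req_dec x y) as [->|Hne]; [lra|].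
  destruct (MVT_cor2 (lower_growth M) (fun s => 1 - 2 * M * ln (1 + s)) x y ltac:(lra))
    as (s & Hs & Hsxy).
  { intros s Hs. apply is_derive_Reals. unfold lower_growth. auto_derive; [lra|]. field. lra. }
  pose proof (two_M_ln_le_1 s ltac:(lra)). nra.
Qed.

(** Im F vanishes on the real axis and is strictly increasing along vertical segments, so a preimage
    of the real number -x would have to be real. *)
Lemma extremal_omits (x : R) (z : C) :
  lower_growth M 1 < x -> Cmod z < 1 -> extremal M z <> RtoC (- x).
Proof.
  intros Hx Hz E.
  assert (H1 := is_pser_dcoef _ _ extremal_pser).
  assert (HL0 : 0 <= lower_growth M 1).
  { replace 0 with (lower_growth M 0) by (unfold lower_growth; rewrite Rplus_0_r, ln_1; ring).
    apply lower_growth_increasing; lra. }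
  (* Re h' > 0 along the vertical segment from the real axis to z. *)
  assert (Hy : snd z = 0).
  { apply NNPP. intro Hy.
    set (p := RtoC (fst z)).
    assert (Hseg : forall s, Rabs s <= Rabs (snd z) -> Cmod (p + RtoC s * Ci)%C < 1).
    { intros s Hs. eapply Rle_lt_trans; [|exact Hz].
      unfold Cmod. apply sqrt_le_1_alt. unfold p, Cplus, Cmult, RtoC, Ci. simpl.
      assert (Hsq : s * s <= snd z * snd z) by (apply Rsqr_le_abs_1; exact Hs). nra. }
    assert (Hend : (p + RtoC (snd z) * Ci)%C = z).
    { apply injective_projections; unfold p, Cplus, Cmult, RtoC, Ci; simpl; ring. }
    set (q := fun s : R => Re (- Ci * extremal M (p + RtoC s * Ci))%C).
    set (dq := fun s : R => Re (- Ci * (Ci * psum (dcoef c) (p + RtoC s * Ci)))%C).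
    assert (Hq : forall s, Rabs s <= Rabs (snd z) -> is_derive q s (dq s)).
    { intros s Hs. apply is_derive_Reals.
      apply (pser_derive_line c _ _ (- Ci)%C p Ci s extremal_pser H1). apply Hseg, Hs. }
    (* The sign of [snd z] is unknown, hence the version for unordered end points and the bounds
       through [Rabs]. *)
    destruct (MVT_gen q 0 (snd z) dq) as (s & Hs & Hqs).
    { intros s Hs. apply Hq. unfold Rmin, Rmax in Hs. destruct (Rle_dec 0 (snd z)).
      - rewrite !Rabs_pos_eq; lra.
      - rewrite !Rabs_left1; lra. }
    { intros s Hs. apply derivable_continuous_pt, ex_derive_Reals_0.
      exists (dq s). apply Hq. unfold Rmin, Rmax in Hs. destruct (Rle_dec 0 (snd z)).
      - rewrite !Rabs_pos_eq; lra.
      - rewrite !Rabs_left1; lra. }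
    assert (Hs' : Rabs s <= Rabs (snd z)).
    { unfold Rmin, Rmax in Hs. destruct (Rle_dec 0 (snd z)).
      - rewrite !Rabs_pos_eq; lra.
      - rewrite !Rabs_left1; lra. }
    assert (Hdq : 0 < dq s).
    { unfold dq. replace (- Ci * (Ci * psum (dcoef c) (p + RtoC s * Ci)))%C
        with (psum (dcoef c) (p + RtoC s * Ci))
        by (apply injective_projections; unfold Cmult, Copp, Ci; simpl; ring).
      pose proof (half_plane_first M c _ extremal_pser eq_refl extremal_half_plane _ (Hseg s Hs')) as Hf.
      set (m := Cmod (p + RtoC s * Ci)%C) in *.
      assert (Hm : 0 <= m < 1) by (split; [apply Cmod_ge_0 | exact (Hseg s Hs')]).
      (* At M = 1/ln 4 the bound 2M ln 2 <= 1 is an equality; strict positivity comes from m < 1. *)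
      assert (ln (1 + m) < ln 2) by (apply ln_increasing; lra).
      pose proof (two_M_ln_le_1 1 ltac:(lra)) as H2.
      replace (1 + 1) with 2 in H2 by ring. nra. }
    assert (HIm : forall w, Re (- Ci * w)%C = Im w)
      by (intro w; unfold Re, Im, Cmult, Copp, Ci; simpl; ring).
    unfold q in Hqs. rewrite !HIm, Hend, E in Hqs.
    replace (p + RtoC 0 * Ci)%C with (RtoC (fst z)) in Hqs by (unfold p; ring).
    rewrite extremal_real_axis in Hqs. simpl in Hqs.
    assert (Hprod : dq s * snd z = 0) by lra.
    apply Rmult_integral in Hprod. destruct Hprod; [lra | contradiction]. }
  assert (Ez : z = RtoC (fst z)) by (apply injective_projections; [reflexivity | exact Hy]).
  rewrite Ez in E, Hz. rewrite Cmod_R in Hz.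
  (* On the negative side the exact value is -l(|z|) >= -l(1) > -x; on the positive side the growth
     bound makes the value nonnegative. *)
  destruct (Rle_or_lt (fst z) 0) as [Hneg|Hpos].
  - rewrite Rabs_left1 in Hz by exact Hneg.
    pose proof (extremal_negative_axis (- fst z) ltac:(lra)) as Hn.
    rewrite Ropp_involutive, E, re_RtoC in Hn.
    pose proof (lower_growth_increasing (- fst z) 1 ltac:(lra) ltac:(lra)). lra.
  - rewrite Rabs_pos_eq in Hz by lra.
    assert (Hzr : Cmod (RtoC (fst z)) = fst z) by (rewrite Cmod_R, Rabs_pos_eq; lra).
    pose proof (half_plane_growth M c _ extremal_pser eq_refl eq_refl extremal_half_plane
      (RtoC (fst z)) ltac:(lra)) as Hg.
    rewrite Hzr, E in Hg.
    replace (Re (Cconj (RtoC (fst z)) * RtoC (- x))%C) with (- (fst z * x)) in Hg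
      by (unfold Re, Cconj, Cmult, RtoC; simpl; ring).
    assert (Hl : 0 <= lower_growth M (fst z)).
    { replace 0 with (lower_growth M 0) by (unfold lower_growth; rewrite Rplus_0_r, ln_1; ring).
      apply lower_growth_increasing; lra. }
    assert (0 < fst z * x) by (apply Rmult_lt_0_compat; lra).
    assert (0 <= fst z * lower_growth M (fst z)) by (apply Rmult_le_pos; lra).
    lra.
Qed.

End Extremal.

(** Take s as the supremum of the t in [0,x] with -t in E. Points of E come arbitrarily near -s, and
    the omitted points are those just beyond it, or -x itself when s = x. *)
Lemma boundary_on_segment (E : C -> Prop) (x : R) :
  0 <= x -> E (RtoC 0) -> ~ E (RtoC (- x)) ->
  exists s, 0 <= s <= x /\ boundary E (RtoC (- s)).
Proof.
  intros Hx H0 Hxn.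
  set (S := fun s => 0 <= s <= x /\ E (RtoC (- s))).
  assert (S0 : S 0) by (split; [lra | rewrite Ropp_0; exact H0]).
  destruct (completeness S) as [s [Hub Hlub]].
  { exists x. intros y [Hy _]. lra. }
  { exists 0. exact S0. }
  assert (Hs0 : 0 <= s) by (apply Hub; exact S0).
  assert (Hsx : s <= x) by (apply Hlub; intros y [Hy _]; lra).
  assert (Hdist : forall u, Cmod (RtoC (- u) - RtoC (- s))%C = Rabs (u - s)).
  { intro u. rewrite <- RtoC_minus, Cmod_R, <- Rabs_Ropp. f_equal. ring. }
  exists s. split; [lra|]. intros eps Heps. split.
  - apply NNPP. intro Hn.
    assert (s <= s - eps); [|lra].
    apply Hlub. intros y Hy.
    destruct (Rle_or_lt y (s - eps)) as [|Hlt]; [assumption|].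
    exfalso. apply Hn. exists (RtoC (- y)). split; [apply Hy|].
    rewrite Hdist. pose proof (Hub y Hy). rewrite Rabs_left1; lra.
  - destruct (Req_dec s x) as [->|Hne].
    + exists (RtoC (- x)). split; [exact Hxn|].
      rewrite Hdist, Rminus_diag, Rabs_R0. exact Heps.
    + set (u := Rmin x (s + eps / 2)).
      assert (Hu1 : s < u) by (apply Rmin_glb_lt; lra).
      assert (Hu2 : u <= x) by apply Rmin_l.
      assert (Hu3 : u <= s + eps / 2) by apply Rmin_r.
      exists (RtoC (- u)). split.
      * intro HE. assert (Su : S u) by (split; [lra | exact HE]).
        pose proof (Hub u Su). lra.
      * rewrite Hdist, Rabs_pos_eq; lra.
Qed.

(** A bound by each x above l(1) is enough for a strict inequality and avoids deciding whether -l(1)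
    itself is omitted. *)
Lemma extremal_boundary_distance_le (M x : R) :
  0 < M -> M <= 1 / ln 4 -> lower_growth M 1 < x -> 0 <= x ->
  Rbar_le (boundary_distance (harmonic_map (extremal M) (fun _ => 0%C))) x.
Proof.
  intros HM HM4 Hx Hx0.
  set (f := harmonic_map (extremal M) (fun _ => 0%C)).
  assert (Hf : forall z, f z = extremal M z).
  { intro z. unfold f, harmonic_map. apply injective_projections; simpl; ring. }
  assert (Hf0 : f 0%C = 0%C) by (rewrite Hf; exact (extremal_at_0 M HM)).
  destruct (boundary_on_segment (image_disk f) x Hx0) as (s & Hs & Hb).
  - exists 0%C. split; [unfold unit_disk; rewrite Cmod_0; lra | exact Hf0].
  - intros (z & Hz & Ez). rewrite Hf in Ez.
    exact (extremal_omits M HM HM4 x z Hx Hz Ez).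
  - apply Rbar_le_trans with (Finite s); [|simpl; lra].
    unfold boundary_distance, distance.
    apply (proj1 (Glb_Rbar_correct _)).
    exists (RtoC (- s)). split; [exact Hb|].
    rewrite Hf0. replace (RtoC (- s) - 0)%C with (RtoC (- s)) by ring.
    rewrite Cmod_R, Rabs_Ropp, Rabs_pos_eq; lra.
Qed.

Theorem theorem3p4 (M : R) (phi : nat -> R -> R)
  (hM : 0 < M)
  (hphi : class_F phi)
  (hphi0 : filterlim (phi 0%nat) (at_left 1) (locally 1))
  (hsum : phi_sum phi 0 < 1 / (2 * M) + 1 - ln 4) :
  exists RM : R,
    (0 < RM < 1 /\ radius_equation M phi RM) /\
    (forall (h g : C -> C) (a b : nat -> C),
       class_P0H M h g -> has_coefficients h g a b ->
       forall r : R, 0 <= r <= RM ->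
         Rbar_le (bohr_sum a b phi r)
                 (boundary_distance (harmonic_map h g))) /\
    ((forall r : R, 0 < r < 1 -> radius_equation M phi r -> r = RM) ->
     M <= 1 / ln 4 ->
     forall r : R, RM < r < 1 ->
       exists (h g : C -> C) (a b : nat -> C),
         class_P0H M h g /\ has_coefficients h g a b /\
         Rbar_lt (boundary_distance (harmonic_map h g))
                 (bohr_sum a b phi r)).
Proof.
  set (L := lower_growth M 1).
  assert (HLeq : L = 1 + 2 * M * (1 - 2 * ln 2)) by apply lower_growth_1.
  assert (HL1 : L < 1) by (pose proof ln_lt_2; nra).
  set (G := fun r => (r * phi 0%nat r + 2 * M * phi_sum phi r) + - L).
  assert (Hrad : forall r, radius_equation M phi r <-> G r = 0).
  { intro r. unfold radius_equation, G. rewrite Series2_alternating, <- HLeq. lra. }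
  assert (HGcont : continuous_on_01 G).
  { unfold G. repeat apply continuous_on_01_plus.
    - apply continuous_on_01_mult; [apply continuous_on_01_id | apply (proj1 hphi)].
    - apply continuous_on_01_mult;
        [apply continuous_on_01_const | exact (continuous_on_01_phi_sum phi hphi)].
    - apply continuous_on_01_const. }
  assert (HG0 : G 0 < 0).
  { unfold G. rewrite Rmult_0_l, Rplus_0_l, HLeq.
    rewrite ln_4 in hsum.
    apply (Rmult_lt_compat_l (2 * M)) in hsum; [|lra].
    replace (2 * M * (1 / (2 * M) + 1 - 2 * ln 2)) with (1 + 2 * M * (1 - 2 * ln 2)) in hsum
      by (field; lra).
    lra. }
  (* The weighted sum at 0 is nonnegative, so [hsum] forces l(1) > 0; this later makes the segment
     from 0 to the omitted value well placed. *)
  assert (HL0 : 0 < L).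
  { pose proof (phi_sum_nonneg phi hphi 0 ltac:(lra)).
    unfold G in HG0. assert (0 <= 2 * M * phi_sum phi 0) by (apply Rmult_le_pos; lra). lra. }
  assert (HGend : forall b, b < 1 -> exists r, b < r < 1 /\ 0 < r /\ 0 < G r).
  { intros b Hb.
    assert (Heta : 0 < (1 - L) / 2) by lra.
    destruct (proj1 (filterlim_locally _ _) hphi0 (mkposreal _ Heta)) as [d Hd].
    (* With delta = 1 - L, e <= delta/4 and phi_0 within delta/2 of 1 give (1 - delta/4)(1 -
       delta/2) > 1 - delta = L. The other two bounds keep 1 - e in the neighbourhood and above
       b. *)
    set (e := Rmin (Rmin (d / 2) ((1 - b) / 2)) ((1 - L) / 4)).
    pose proof (cond_pos d).
    assert (He0 : 0 < e) by (unfold e; repeat apply Rmin_glb_lt; lra).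
    assert (He1 : e <= (1 - L) / 4) by apply Rmin_r.
    assert (He2 : e <= Rmin (d / 2) ((1 - b) / 2)) by apply Rmin_l.
    pose proof (Rmin_l (d / 2) ((1 - b) / 2)). pose proof (Rmin_r (d / 2) ((1 - b) / 2)).
    exists (1 - e). split; [lra|]. split; [lra|].
    assert (Hball : Rabs ((1 - e) - 1) < d) by (rewrite Rabs_left1; lra).
    specialize (Hd (1 - e) Hball ltac:(lra)).
    change (Rabs (phi 0%nat (1 - e) - 1) < (1 - L) / 2) in Hd.
    apply Rabs_lt_between in Hd.
    pose proof (phi_sum_nonneg phi hphi (1 - e) ltac:(lra)).
    assert (0 <= 2 * M * phi_sum phi (1 - e)) by (apply Rmult_le_pos; lra).
    unfold G.
    assert ((1 - (1 - L) / 4) * (1 - (1 - L) / 2) <= (1 - e) * phi 0%nat (1 - e))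
      by (apply Rmult_le_compat; lra).
    nra. }
  destruct (HGend 0 ltac:(lra)) as (r1 & Hr1 & _ & HGr1).
  destruct (first_crossing G 0 r1 HGcont ltac:(lra) ltac:(lra) ltac:(lra) HG0 HGr1)
    as (RM & HRM & HGRM & HGle).
  exists RM. split; [split; [lra | now apply Hrad]|]. split.
  - intros h g a b HP Hab r Hr.
    eapply Rbar_le_trans; [|exact (class_boundary_distance_ge M h g a b HP Hab)].
    eapply Rbar_le_trans; [exact (class_bohr_sum_le M h g a b hM HP Hab phi r hphi ltac:(lra))|].
    simpl. specialize (HGle r ltac:(lra)). unfold G in HGle. fold L. lra.
  - intros Huniq HM4 r Hr.
    assert (HGr : 0 < G r).
    { apply Rnot_le_lt. intro Hle.
      assert (Hne : G r <> 0).
      { intro E. apply Hrad in E. apply Huniq in E; lra. }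
      (* If G were negative at r, its positivity near 1 would create a second root between r and r2,
         against uniqueness. *)
      destruct (HGend r ltac:(lra)) as (r2 & Hr2 & _ & HGr2).
      destruct (first_crossing G r r2 HGcont ltac:(lra) ltac:(lra) ltac:(lra) ltac:(lra) HGr2)
        as (x & Hx & HGx & _).
      apply Hrad in HGx. apply Huniq in HGx; lra. }
    exists (extremal M), (fun _ => 0%C), (extremal_coef M), (fun _ => 0%C).
    split; [exact (extremal_class M hM)|].
    split; [exact (extremal_has_coefficients M hM)|].
    rewrite (extremal_bohr_sum M hM phi r hphi ltac:(lra)).
    (* The Bohr sum of the extremal map is L + G r, and the midpoint L + G r / 2 lies strictly
       between L and it. *)
    eapply Rbar_le_lt_trans;
      [apply (extremal_boundary_distance_le M (L + G r / 2) hM HM4); fold L; lra|].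
    simpl. unfold G. unfold G in HGr. lra.
Qed.
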